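(* Let $\mathrm{pnt}(K_{N,N})$ and $\mathrm{ch}(K_{N,N})$ denote the paint number and the choice number, respectively, of the complete bipartite graph $K_{N,N}$ with $N$ vertices in each part. Then, as $N\to\infty$, $$\mathrm{pnt}(K_{N,N}) - \mathrm{ch}(K_{N,N}) = \Omega(\log\log N),$$ where $\log$ is the logarithm to base $2$.
   Context: On-line list coloring game. Given a finite graph $G=(V,E)$ and a function $f:V\to\mathbb{N}$, two players, Lister and Painter, play in rounds. In the $i$-th round Lister presents a nonempty set of vertices $V_i \subseteq V\setminus\bigcup_{j=1}^{i-1}X_j$, and Painter chooses $X_i \subseteq V_i$ that is an independent set in $G$. After $i$ rounds, the vertices in $\bigcup_{j=1}^{i}X_j$ are called colored. If a vertex $v$ belongs to exactly $l$ of the sets $V_1,\ldots,V_i$, we say $v$ has $l$ permissible colors after $i$ rounds. Lister wins if after some round there exists an uncolored vertex $v$ with $f(v)$ permissible colors. If this never happens, then eventually all vertices are colored and Painter wins. The graph $G$ is $f$-paintable if Painter has a winning strategy, and $k$-paintable if it is $f$-paintable for the constant function $f(x)=k$. The smallest $k$ such that $G$ is $k$-paintable is the paint number of $G$, denoted $\mathrm{pnt}(G)$. The choice number (list chromatic number) $\mathrm{ch}(G)$ is the smallest $k$ such that for every assignment of a list of $k$ colors to each vertex of $G$ there is a proper coloring of $G$ in which each vertex receives a color from its list. *)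

(* Defs.v *)
From mathcomp Require Import all_boot all_order all_algebra finmap.
From mathcomp Require Import boolp reals exp.

Set Implicit Arguments.
Unset Strict Implicit.
Unset Printing Implicit Defensive.

Import Order.TTheory GRing.Theory Num.Theory.

Record sgraph := SGraph {
  vertex :> finType;
  adj : rel vertex;
  adj_sym : symmetric adj;
  adj_irr : irreflexive adj }.

Definition independent (G : sgraph) (A : {set G}) : Prop :=
  forall u v, u \in A -> v \in A -> ~~ adj u v.

Section OnlineGame.
Variable G : sgraph.

(* The i-th round of the game is the pair (V_i, X_i) of the set presented by
   Lister and the set coloured by Painter; a history lists the rounds played
   so far, oldest first. *)
Definition round : Type := ({set G} * {set G})%type.
Implicit Types (h : seq round) (V : {set G}).

Definition colored h : {set G} := (\bigcup_(r <- h) r.2).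

Definition permissible h (v : G) : nat := count (fun r : round => v \in r.1) h.

Definition lister_move h V : Prop := V != set0 /\ [disjoint V & colored h].

Definition painter_move V (X : {set G}) : Prop := X \subset V /\ independent X.

Definition lister_wins (f : G -> nat) h : Prop :=
  h <> [::] /\ exists v : G, v \notin colored h /\ permissible h v = f v.

Definition painter_strategy : Type := seq round -> {set G} -> {set G}.

(* The histories that can arise when Painter follows s. *)
Inductive reachable (s : painter_strategy) : seq round -> Prop :=
| reachable_nil : reachable s [::]
| reachable_rcons h V : reachable s h -> lister_move h V ->
    reachable s (rcons h (V, s h V)).

(* Every round presents an uncoloured vertex, so for positive f a play in which
   lister_wins never holds is finite and ends with all vertices coloured. *)
Definition winning (f : G -> nat) (s : painter_strategy) : Prop :=
  (forall h V, reachable s h -> lister_move h V -> painter_move V (s h V)) /\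
  (forall h, reachable s h -> ~ lister_wins f h).

Definition f_paintable (f : G -> nat) : Prop :=
  exists s : painter_strategy, winning f s.

Definition paintable (k : nat) : Prop := f_paintable (fun=> k).

Definition choosable (k : nat) : Prop :=
  forall (C : choiceType) (L : G -> {fset C}),
    (forall v, #|` L v| = k) ->
    exists c : G -> C,
      (forall v, c v \in L v) /\ (forall u v, adj u v -> c u <> c v).

Lemma colored_rcons h r : colored (rcons h r) = (colored h :|: r.2).
Proof. by rewrite /colored -cats1 big_cat big_seq1. Qed.

(* Painter colours a single vertex in each round. *)
Lemma paintable_ex : exists k, `[< paintable k >].
Proof.
exists #|G|; apply/asboolP.
pose s : painter_strategy := fun _ V =>
  if [pick v in V] is Some v then set1 v else set0.
have sP h V : V != set0 -> exists2 v, v \in V & s h V = set1 v.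
  move=> /set0Pn[x xV]; rewrite /s; case: pickP => [v vV|/(_ x)]; last by rewrite xV.
  by exists v.
exists s; split.
  move=> h V _ [/(sP h)[v vV ->] _]; split; first by rewrite sub1set.
  by move=> a b; rewrite !inE => /eqP-> /eqP->; rewrite adj_irr.
have sz h : reachable s h -> size h = #|colored h|.
  elim=> [|{}h V _ IH [/(sP h)[v vV sv] dV]].
    by rewrite /colored big_nil cards0.
  rewrite size_rcons colored_rcons /= sv setUC cardsU1 IH.
  by rewrite (disjointFr dV vV).
move=> h /sz sh [_ [v [vC pv]]].
have : (#|colored h| < #|G|)%N.
  rewrite -cardsT; apply: proper_card; rewrite properEneq subsetT andbT.
  by apply: contra vC => /eqP->; rewrite in_setT.
by rewrite -sh -pv ltnNge count_size.
Qed.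

Lemma choosable_ex : exists k, `[< choosable k >].
Proof.
exists #|G|; apply/asboolP => C L Lk.
have /boolp.choice [c0 c0P] : forall v, exists x, x \in L v.
  move=> v; apply/fset0Pn; rewrite -cardfs_gt0 Lk; apply/card_gt0P; by exists v.
have H : forall t : seq G, uniq t -> exists c : G -> C,
    (forall v, c v \in L v) /\ {in t &, injective c}.
  elim=> [_|v t IH /= /andP[vt ut]]; first by exists c0.
  have [c [cL ci]] := IH ut.
  have [x xL xt] : exists2 x, x \in L v & x \notin [seq c u | u <- t].
    apply: contrapT => nx.
    have : (#|` L v| <= size [seq c u | u <- t])%N.
      rewrite cardfE cardE -(size_map val); apply: uniq_leq_size.
        by rewrite map_inj_uniq ?enum_uniq //; apply: val_inj.
      move=> _ /mapP[y _ ->]; apply: contrapT => /negP n; apply: nx.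
      by exists (val y); first exact: valP.
    rewrite Lk size_map leqNgt => /negP; apply.
    apply: (@leq_trans (size (v :: t))) => //.
    rewrite -(card_uniqP _) ?max_card //=; exact/andP.
  exists (fun u => if u == v then x else c u); split=> [u|a b].
    by case: eqP => [->|].
  rewrite !inE; case: (eqVneq a v) => [->|_]; case: (eqVneq b v) => [->|_] //=.
  - by move=> _ bt xc; case/negP: xt; rewrite xc map_f.
  - by move=> at_ _ xc; case/negP: xt; rewrite -xc map_f.
  - exact: ci.
have [c [cL ci]] := H (enum G) (enum_uniq _).
exists c; split=> // u v uv cuv.
have E : u = v by apply: ci; rewrite ?mem_enum.
by move: uv; rewrite E adj_irr.
Qed.

Definition paint_number : nat := ex_minn paintable_ex.

Definition choice_number : nat := ex_minn choosable_ex.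

End OnlineGame.

Section CompleteBipartite.
Variables m n : nat.

Definition biclique_adj : rel ('I_m + 'I_n)%type := fun u v =>
  match u, v with
  | inl _, inr _ | inr _, inl _ => true
  | _, _ => false
  end.

Lemma biclique_sym : symmetric biclique_adj.
Proof. by move=> [u|u] [v|v]. Qed.

Lemma biclique_irr : irreflexive biclique_adj.
Proof. by move=> [u|u]. Qed.

Definition biclique : sgraph := SGraph biclique_sym biclique_irr.

End CompleteBipartite.

Definition log2 (R : realType) (x : R) : R := (ln x / ln 2)%R.

(* Main.v *)
Require Import Defs.
From mathcomp Require Import all_boot all_order all_algebra finmap.
From mathcomp Require Import boolp reals exp.
From mathcomp Require Import ring lra zify.

(* With 20 l close to log k, the graph K_{N,N} is k-choosable for
   N <= 2^(k + 9 l - 3), but not k-paintable for N = 2^(k + 8 l), so the two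
   numbers differ by about l, which is of order log log N.

   Choosability.  Give the colours random weights and scan them by increasing
   weight, reserving a colour for the left side unless this would exhaust the
   list of some right vertex.  This only fails when a left list and a right list
   meet in a single colour that is the lightest of the former and the heaviest
   of the latter, which for small N is too rare an event to be certain.

   Paintability.  A vertex is a chip standing at the level given by its number
   of permissible colours.  In each round Lister presents a fraction 1/M of every
   level below k - 60 l on both sides, so that chips reaching that level are
   frozen there.  Painter kills the presented chips of one side and advances
   those of the other, hence the replies form a lattice path that determines the
   chips up to rounding.  If one side is far ahead of the other during the last
   rounds, so many of its chips are frozen that they can be spent on the other
   side: presented alone against groups of chips of one level, a frozen chip
   either reaches level k or is killed at the price of advancing the group.
   Otherwise both sides have 2^(61 l) frozen chips, and 60 l more levels are
   gained by presenting a fixed fraction of all levels again. *)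

Set Implicit Arguments.
Unset Strict Implicit.
Unset Printing Implicit Defensive.

Import Order.TTheory GRing.Theory Num.Theory.

(** * The chip game *)

Definition shift_up (p : nat -> nat) (i : nat) : nat :=
  if i is i'.+1 then p i' else 0.

(* a and b count the uncoloured left and right vertices by their number of
   permissible colours.  Painter colours the presented vertices of one side, and
   those of the other side gain a permissible colour. *)
Inductive lister_forces (k : nat) : (nat -> nat) -> (nat -> nat) -> Prop :=
| forces_left a b i : k <= i -> 0 < a i -> lister_forces k a b
| forces_right a b i : k <= i -> 0 < b i -> lister_forces k a b
| forces_round a b p q :
    (forall i, p i <= a i) -> (forall i, q i <= b i) ->
    lister_forces k (fun i => a i - p i) (fun i => b i - q i + shift_up q i) ->
    lister_forces k (fun i => a i - p i + shift_up p i) (fun i => b i - q i) ->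
    lister_forces k a b.

Lemma forces_mono k a b a' b' : (forall i, a i <= a' i) -> (forall i, b i <= b' i) ->
  lister_forces k a b -> lister_forces k a' b'.
Proof.
move=> aa bb F; elim: F a' b' aa bb => {a b}.
- by move=> a b i ki ai a' b' aa _; apply: (forces_left _ ki); apply: leq_trans (aa i).
- by move=> a b i ki bi a' b' _ bb; apply: (forces_right _ ki); apply: leq_trans (bb i).
- move=> a b p q pa qb _ IH1 _ IH2 a' b' aa bb.
  apply: (@forces_round _ _ _ p q) => [i|i||].
  + exact: leq_trans (aa i).
  + exact: leq_trans (bb i).
  + by apply: IH1 => i; [apply: leq_sub2r | rewrite leq_add2r leq_sub2r].
  + by apply: IH2 => i; [rewrite leq_add2r leq_sub2r | apply: leq_sub2r].
Qed.

Lemma forces_sym k a b : lister_forces k a b -> lister_forces k b a.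
Proof.
elim=> {a b}.
- by move=> a b i; apply: forces_right.
- by move=> a b i; apply: forces_left.
- by move=> a b p q pa qb _ IH1 _ IH2; apply: (@forces_round _ _ _ q p).
Qed.

(** * From the chip game to the painting game *)

Section Soundness.
Variables N f : nat.
Let G := biclique N N.
Variable s : painter_strategy G.
Hypothesis f_gt0 : 0 < f.
Hypothesis sW : winning (fun=> f) s.

Lemma permissible_rcons (h : seq (round G)) r v :
  permissible (rcons h r) v = permissible h v + (v \in r.1).
Proof. by rewrite /permissible -cats1 count_cat /= addn0. Qed.

(** [winning] forbids only equality with [f], but a round adds at most one permissible colour, so a
    count starting below [f] cannot jump over it. *)
Lemma uncolored_permissible_lt (h : seq (round G)) v : reachable s h -> v \notin colored h ->
  permissible h v < f.
Proof.
move=> hR; elim: hR v => [v _|{}h V hR IH hV v]; first exact: f_gt0.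
move=> vC; have hR' := reachable_rcons hR hV.
have := vC; rewrite colored_rcons in_setU negb_or => /andP[/IH lt _].
have := sW.2 _ hR'; rewrite /lister_wins => nw.
have ne : permissible (rcons h (V, s h V)) v <> f.
  move=> e; apply: nw; split; first by case: (h).
  by exists v.
move: ne lt; rewrite permissible_rcons /=; case: (_ \in _); lia.
Qed.

Definition at_level (emb : 'I_N -> G) (h : seq (round G)) (i : nat) : {set 'I_N} :=
  [set v | (emb v \notin colored h) && (permissible h (emb v) == i)].

Lemma choose_at_level (emb : 'I_N -> G) h (p a : nat -> nat) :
  (forall i, p i <= a i) -> (forall i, a i <= #|at_level emb h i|) ->
  exists P : {set 'I_N}, (forall v, v \in P -> emb v \notin colored h) /\
    forall i, #|P :&: at_level emb h i| = p i.
Proof.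
move=> pa aL.
have /boolp.choice[F FP] : forall i, exists S : {set 'I_N},
    S \subset at_level emb h i /\ #|S| = p i.
  move=> i.
  have le : p i <= #|at_level emb h i| := leq_trans (pa i) (aL i).
  exists [set x in take (p i) (enum (at_level emb h i))]; split.
    by apply/subsetP => x; rewrite inE => /mem_take; rewrite mem_enum.
  rewrite cardsE (card_uniqP _) ?take_uniq ?enum_uniq // size_takel //.
  by rewrite -cardE.
exists [set v | (emb v \notin colored h) && (v \in F (permissible h (emb v)))]; split.
  by move=> v; rewrite inE => /andP[].
move=> i; rewrite -(FP i).2; congr #|pred_of_set _|.
apply/setP => v; rewrite !inE.
have /subsetP sub := (FP i).1.
apply/idP/idP => [/andP[/andP[_ vF] /andP[_ /eqP <-]]//|vF].
by have := sub _ vF; rewrite inE => /andP[-> /eqP ->]; rewrite eqxx vF.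
Qed.

(** Induction on Lister's plan; [a] and [b] remain lower bounds, as Painter may colour only some of
    the presented vertices. *)
Lemma forces_not_winning k (h : seq (round G)) a b : f <= k ->
  lister_forces k a b -> reachable s h ->
  (forall i, a i <= #|at_level inl h i|) ->
  (forall i, b i <= #|at_level inr h i|) -> False.
Proof.
move=> fk F; elim: F h => {a b}.
- move=> a b i ki ai h hR aL _.
  have /card_gt0P[v] : 0 < #|at_level inl h i| := leq_trans ai (aL i).
  rewrite inE => /andP[/(uncolored_permissible_lt hR) lt /eqP e].
  by rewrite e ltnNge (leq_trans fk ki) in lt.
- move=> a b i ki bi h hR _ bL.
  have /card_gt0P[v] : 0 < #|at_level inr h i| := leq_trans bi (bL i).
  rewrite inE => /andP[/(uncolored_permissible_lt hR) lt /eqP e].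
  by rewrite e ltnNge (leq_trans fk ki) in lt.
move=> a b p q pa qb _ IH1 _ IH2 h hR aL bL.
have [P [Pu Pc]] := choose_at_level pa aL.
have [Q [Qu Qc]] := choose_at_level qb bL.
pose V : {set G} := [set v | match v with inl x => x \in P | inr x => x \in Q end].
have VP x : (inl x \in V) = (x \in P) by rewrite inE.
have VQ x : (inr x \in V) = (x \in Q) by rewrite inE.
(* Presenting nothing is no legal move; then [p] and [q] vanish and the first continuation is the
   present position. *)
have [V0|Vn0] := eqVneq V set0.
  have p0 i : p i = 0.
    rewrite -(Pc i); apply/eqP; rewrite cards_eq0 -subset0; apply/subsetP => x.
    by rewrite in_setI -VP V0 !in_set0.
  have q0 i : q i = 0.
    rewrite -(Qc i); apply/eqP; rewrite cards_eq0 -subset0; apply/subsetP => x.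
    by rewrite in_setI -VQ V0 !in_set0.
  apply: (IH1 h hR) => i; first by rewrite p0 subn0.
  by rewrite q0 subn0; case: i => [|i]; rewrite /= ?q0 addn0.
have hV : lister_move h V.
  split=> //; apply/pred0P => -[x|x] /=; apply/negP => /andP[].
  + by rewrite VP => /Pu /negbTE ->.
  + by rewrite VQ => /Qu /negbTE ->.
have [XV Xi] := sW.1 h V hR hV.
have hR' := reachable_rcons hR hV.
set X := s h V in XV Xi hR'.
(* Both cases below come from the following two bounds for one side. *)
have killed (emb : 'I_N -> G) (S : {set 'I_N}) c r :
    (forall x, (emb x \in V) = (x \in S)) ->
    (forall i, c i <= #|at_level emb h i|) ->
    (forall i, #|S :&: at_level emb h i| = r i) ->
    forall i, c i - r i <= #|at_level emb (rcons h (V, X)) i|.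
  move=> eS cL rS i; apply: leq_trans (leq_sub2r _ (cL i)) _.
  rewrite -(rS i) setIC -cardsD; apply: subset_leq_card; apply/subsetP => x.
  rewrite !inE colored_rcons in_setU negb_or permissible_rcons /= eS.
  case/andP=> xS /andP[-> /eqP ->]; rewrite (negbTE xS) addn0 eqxx andbT /=.
  by apply: contra xS => /(subsetP XV); rewrite eS.
have moved (emb : 'I_N -> G) (S : {set 'I_N}) c r :
    (forall x, emb x \notin X) ->
    (forall x, (emb x \in V) = (x \in S)) ->
    (forall i, c i <= #|at_level emb h i|) ->
    (forall i, #|S :&: at_level emb h i| = r i) ->
    forall i, c i - r i + shift_up r i <= #|at_level emb (rcons h (V, X)) i|.
  move=> eX eS cL rS i.
  pose A := at_level emb h i :\: S.
  pose B := if i is i'.+1 then S :&: at_level emb h i' else set0.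
  have cB : #|B| = shift_up r i by rewrite /B; case: (i) => [|i'] /=; rewrite ?cards0.
  have AB : [disjoint A & B].
    apply/pred0P => x /=; rewrite /A /B; case: (i) => [|i']; rewrite !inE ?andbF //.
    by case: (x \in S); rewrite /= ?andbF.
  have cA : c i - r i <= #|A|.
    by rewrite cardsD setIC rS leq_sub2r.
  apply: (@leq_trans (#|A :|: B|)).
    by rewrite cardsU disjoint_setI0 // cards0 subn0 cB leq_add2r.
  apply: subset_leq_card; apply/subsetP => x.
  rewrite !inE colored_rcons in_setU negb_or permissible_rcons /= eS (eX x) andbT.
  case/orP=> [/andP[/negbTE -> /andP[-> /eqP->]]|].
    by rewrite addn0 eqxx.
  rewrite /B; case: (i) => [|i']; rewrite !inE // => /andP[-> /andP[-> /eqP ->]].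
  by rewrite addn1 eqxx.
(* An independent set misses one side. If it misses the left one, in particular if it is empty, the
   second continuation applies. *)
have [/existsP[x xX]|/existsPn nl] := boolP [exists x : 'I_N, (inl x : G) \in X].
  have nr (y : 'I_N) : (inr y : G) \notin X.
    by apply/negP => yX; have := Xi _ _ xX yX.
  apply: (IH1 _ hR'); first exact: (killed inl P).
  exact: (moved inr Q).
apply: (IH2 _ hR'); last exact: (killed inr Q).
exact: (moved inl P).
Qed.

End Soundness.

Definition at_origin (n i : nat) : nat := if i == 0 then n else 0.

Lemma forces_paint_number N k : 1 < N -> lister_forces k (at_origin N) (at_origin N) ->
  k < paint_number (biclique N N).
Proof.
move=> N1 F; rewrite ltnNge; apply/negP => fk; move: fk.
rewrite /paint_number; case: ex_minnP => f /asboolP [s sW] _ fk.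
have col0 : colored ([::] : seq (round (biclique N N))) = set0.
  by rewrite /colored big_nil.
case: (posnP f) => [f0|f0]; last first.
  apply: (forces_not_winning f0 sW fk F (reachable_nil s)) => -[|i] //=.
    rewrite /at_origin /= -{1}(card_ord N) -cardsT; apply: subset_leq_card.
    by apply/subsetP => x; rewrite !inE col0 in_set0.
  rewrite /at_origin /= -{1}(card_ord N) -cardsT; apply: subset_leq_card.
  by apply/subsetP => x; rewrite !inE col0 in_set0.
(* [lister_wins] needs a round to have been played, so for [f = 0] Lister presents [x0] alone; then
   [x1] is uncoloured with no permissible colour. *)
pose x0 : biclique N N := inl (Ordinal (ltnW N1)).
pose x1 : biclique N N := inl (Ordinal N1).
have hV : lister_move ([::] : seq (round (biclique N N))) [set x0].
  split; first by apply/set0Pn; exists x0; rewrite in_set1.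
  by rewrite col0; apply/pred0P => x; rewrite /= in_set0 andbF.
have hR := reachable_rcons (reachable_nil s) hV.
have [/subsetP XV _] := sW.1 _ _ (reachable_nil s) hV.
apply: (sW.2 _ hR); split=> //; exists x1.
have n01 : x1 \notin [set x0] by rewrite in_set1.
rewrite colored_rcons col0 set0U permissible_rcons /= (negbTE n01) f0.
by split=> //; apply: contra n01; apply: XV.
Qed.

Definition shift_by (o : nat) (a : nat -> nat) (i : nat) : nat :=
  if i < o then 0 else a (i - o).

Lemma forces_shift o k a b : lister_forces k a b ->
  lister_forces (o + k) (shift_by o a) (shift_by o b).
Proof.
have sh p i : shift_up (shift_by o p) i = shift_by o (shift_up p) i.
  case: i => [|i] /=; rewrite /shift_by; first by case: (0 < o); rewrite ?sub0n.
  case: (ltnP i o) => io; case: (ltnP i.+1 o) => io1 //; try lia.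
    by have -> : i.+1 - o = 0 by lia.
  by have -> : i.+1 - o = (i - o).+1 by lia.
elim=> {a b}.
- move=> a b i ki ai; apply: (@forces_left _ _ _ (o + i)); first by rewrite leq_add2l.
  by rewrite /shift_by ifN ?addKn // -leqNgt leq_addr.
- move=> a b i ki bi; apply: (@forces_right _ _ _ (o + i)); first by rewrite leq_add2l.
  by rewrite /shift_by ifN ?addKn // -leqNgt leq_addr.
- move=> a b p q pa qb _ IH1 _ IH2.
  apply: (@forces_round _ _ _ (shift_by o p) (shift_by o q)) => [i|i||].
  + by rewrite /shift_by; case: ifP.
  + by rewrite /shift_by; case: ifP.
  + by apply: forces_mono IH1 => i; rewrite ?sh /shift_by; case: ifP.
  + by apply: forces_mono IH2 => i; rewrite ?sh /shift_by; case: ifP.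
Qed.

(** * Trading frozen chips of one side for levels of the other *)

Definition psum (y : nat -> nat) i := \sum_(t < i) y t.

Lemma psumS y i : psum y i.+1 = psum y i + y i.
Proof. by rewrite /psum big_ord_recr. Qed.

Lemma psum0 y : psum y 0 = 0.
Proof. by rewrite /psum big_ord0. Qed.

Lemma psum_leq y i j : i <= j -> psum y i <= psum y j.
Proof.
elim: j => [|j IH]; [by case: i | rewrite leq_eqVlt => /predU1P[->//|/IH]].
by rewrite psumS; lia.
Qed.

(* A single right chip at level q is played against disjoint groups of
   c * y 0, c * y 1, ... left chips of level j until Painter kills it. *)
Lemma pursuit k q j c d (y : nat -> nat) z o R : q + d = k ->
  (forall i a b, i < d -> z - c * psum y i.+1 <= a j -> o + c * y i <= a j.+1 ->
     R <= b q -> lister_forces k a b) ->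
  c * psum y d <= z ->
  forall a b, z <= a j -> o <= a j.+1 -> R < b q -> lister_forces k a b.
Proof.
move=> qd K cz.
(* Before step [i] the pursued chip stands at level [q + i] and [i] groups have been killed. For
   [i = 0] it is itself one of the chips of level [q], so there the bound [R] must be strict. *)
have main m : forall i a b, i <= d -> d - i <= m -> z - c * psum y i <= a j ->
    o <= a j.+1 -> R <= b q -> (i = 0 -> R < b q) -> 0 < b (q + i) -> lister_forces k a b.
  elim: m => [|m IH] i a b id dm aj aj1 bq bq0 bi.
    by apply: (forces_right _ _ bi); lia.
  case: (ltnP i d) => [lid|di]; last by apply: (forces_right _ _ bi); lia.
  have cy : c * y i <= a j.
    apply: leq_trans aj; rewrite leq_subRL.
      by apply: leq_trans cz; rewrite -mulnDr -psumS leq_mul2l psum_leq ?orbT.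
    by apply: leq_trans cz; rewrite leq_mul2l psum_leq ?orbT.
  apply: (@forces_round _ _ _ (fun x => if x == j then c * y i else 0)
    (fun x => if x == q + i then 1 else 0)) => [x|x||].
  - by case: eqP => // ->.
  - by case: eqP => // ->.
  - apply: (IH i.+1) => /=; rewrite ?eqxx ?addnS //; try lia.
    + by rewrite psumS mulnDr subnDA leq_sub2r.
    + by rewrite (gtn_eqF (ltnSn j)) subn0.
    + case: eqP bq0; last by lia.
      by move=> e bq0; have i0 : i = 0 by [lia]; rewrite i0; have := bq0 i0; lia.
    + by rewrite /= eqxx addn1.
  - apply: (K i) => //=; rewrite ?eqxx.
    + rewrite psumS mulnDr subnDA; apply: leq_trans (leq_addr _ _).
      exact: leq_sub2r.
    + by rewrite (gtn_eqF (ltnSn j)) subn0 leq_add2r.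
    + case: eqP bq0; last by lia.
      by move=> e bq0; have := bq0 ltac:(lia); lia.
move=> a b aj aj1 bq; apply: (main d 0); rewrite ?psum0 ?muln0 ?subn0 ?addn0 //; lia.
Qed.

(** Pursuits are repeated with one right chip each. Whenever Painter kills that chip, at least a
    fraction [E / D] of the left chips used so far in the pursuit has been lifted. Each pursuit uses
    at least [c * y 0] chips, so [P] of them bring level [j] down to [thr]; before that a full
    pursuit is affordable. *)
Lemma lift_level k q j c d (y : nat -> nat) E D z thr R : q + d = k -> 0 < d ->
  (forall i, i < d -> E * psum y i.+1 <= D * y i) ->
  c * psum y d <= thr ->
  (forall o a b, E * (z - thr) <= D * o -> o <= a j.+1 -> R <= b q ->
     lister_forces k a b) ->
  forall P a b, z - thr <= P * (c * y 0) -> z <= a j -> R + P <= b q ->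
    lister_forces k a b.
Proof.
move=> qd d0 yE cthr K P.
have main : forall P u o a b, z - thr <= P * (c * y 0) + u -> E * u <= D * o ->
    z - u <= a j -> o <= a j.+1 -> R + P <= b q -> lister_forces k a b.
  elim=> [|{}P IH] u o a b Pu Eu aj aj1 bq.
    apply: (K o) => //; last by lia.
    by apply: leq_trans Eu; rewrite leq_mul2l; apply/orP; right; lia.
  case: (leqP (z - thr) u) => [zu|uz].
    by apply: (K o) => //; [apply: leq_trans Eu; rewrite leq_mul2l zu orbT | lia].
  apply: (pursuit (j := j) qd (c := c) (y := y) (z := z - u) (o := o) (R := R + P)) => //; try lia.
  move=> i {aj aj1 bq} {}a {}b lid aj aj1 bq.
  apply: (IH (u + c * psum y i.+1) (o + c * y i)) => //.
  - have : c * y 0 <= c * psum y i.+1.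
      by rewrite leq_mul2l /psum big_ord_recl leq_addr orbT.
    by move: Pu; rewrite mulSn; lia.
  - have := yE _ lid; rewrite !mulnDr => h.
    apply: leq_add => //; rewrite mulnCA (mulnCA D).
    by rewrite leq_mul2l h orbT.
  - by rewrite subnDA.
move=> a b zP aj bq; apply: (main P 0 0) => //; rewrite ?addn0 ?muln0 ?subn0 //.
Qed.

(** On each level all but a fraction [1 / fr] of the chips is used, and a fraction [E / D] of these
    is lifted, so a level costs [P] right chips and a factor [E (fr - 1) / (D fr)]. The scale [c]
    makes a full pursuit fit into the remainder [thr] while using at least half of it. *)
Lemma lift_chips k q d (y : nat -> nat) E D fr P : q + d = k -> 0 < d ->
  (forall i, i < d -> E * psum y i.+1 <= D * y i) ->
  0 < psum y d -> 0 < fr -> E <= D -> 0 < D ->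
  4 * fr * psum y d <= P * y 0 ->
  forall G j z a b, j + G = k ->
    fr * psum y d * (fr * D) ^ G <= z * (E * (fr - 1)) ^ G ->
    z <= a j -> G * P <= b q -> lister_forces k a b.
Proof.
move=> qd d0 yE Y0 fr0 ED D0 hP; set Y := psum y d in Y0 hP *.
elim=> [|G IH] j z a b jG zG aj bq.
  apply: (@forces_left _ _ _ j); first by lia.
  apply: leq_trans aj; move: zG; rewrite !expn0 !muln1; apply: leq_trans.
  by rewrite muln_gt0 fr0.
have zY : fr * Y <= z.
  have := leq_trans zG (_ : _ <= z * (fr * D) ^ G.+1).
  rewrite leq_pmul2r ?expn_gt0 ?muln_gt0 ?fr0 ?D0 //; apply.
  rewrite leq_mul2l leq_exp2r // mulnC leq_mul ?orbT //; lia.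
pose thr := z %/ fr; pose c := thr %/ Y.
have thrY : Y <= thr by rewrite leq_divRL // mulnC.
have c1 : 0 < c by rewrite divn_gt0.
have cY : c * Y <= thr by apply: leq_divM.
apply: (@lift_level k q j c d y E D z thr (G * P) qd d0 yE cY _ P) => //; last 1 first.
- by rewrite addnC -mulSn.
- move=> o {aj bq} {}a {}b Eo aj bq.
  have h1 : z * (fr - 1) <= fr * (z - thr).
    by rewrite mulnBr muln1 mulnBr (mulnC z) leq_sub2l // mulnC leq_divM.
  have h2 : E * (fr - 1) * z <= fr * D * o.
    apply: (@leq_trans (E * (fr * (z - thr)))).
      by rewrite -mulnA leq_mul2l (mulnC (fr - 1)) h1 orbT.
    by rewrite mulnCA -mulnA leq_mul2l Eo orbT.
  apply: (IH j.+1 o) => //; first by rewrite addSnnS.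
  rewrite -(leq_pmul2r (_ : 0 < fr * D)) ?muln_gt0 ?fr0 //.
  rewrite -[_ * _ * (fr * D)]mulnA -expnSr; apply: leq_trans zG _.
  by rewrite expnS mulnA (mulnC z) (mulnAC o) (mulnC o) leq_mul2r h2 orbT.
- have h1 : thr < 2 * (c * Y).
    by apply: leq_trans (ltn_ceil thr Y0) _; rewrite mulSn mul2n -addnn leq_add2r leq_pmull.
  have h2 : z < fr * thr.+1 by rewrite mulnC ltn_ceil.
  have h3 : z <= 4 * fr * (c * Y).
    rewrite (leq_trans (ltnW h2)) // (mulnC 4) -mulnA leq_mul2l (leq_trans h1) ?orbT //.
    by rewrite leq_mul2r orbT.
  rewrite mulnCA; apply: leq_trans (leq_subr _ _) _; apply: leq_trans h3 _.
  by rewrite mulnCA leq_mul2l hP orbT.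
Qed.

(** A geometric progression of ratio [A / B], cleared of denominators. *)
Definition geom A B d i := A ^ i * B ^ (d.-1 - i).

Lemma psum_geom A B d m : B <= A -> m <= d ->
  (A - B) * psum (geom A B d) m + B ^ d = A ^ m * B ^ (d - m).
Proof.
move=> BA; elim: m => [|m IH] md; first by rewrite psum0 muln0 subn0 mul1n.
rewrite psumS mulnDr addnAC IH 1?ltnW // /geom.
have -> : d - m = (d.-1 - m).+1 by lia.
have -> : d - m.+1 = d.-1 - m by lia.
by rewrite !expnS mulnCA -mulnDl subnKC // mulnA.
Qed.

(** In a geometric progression each term is at least a fraction [1 - B / A] of the sum up to it. A
    large ratio wastes few left chips, but the price of a level grows like [(A / B)^d]. *)
Lemma lift_geom k q d A B fr P : q + d = k -> 0 < d -> 0 < B < A -> 0 < fr ->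
  4 * fr * A ^ d <= P * B ^ d.-1 ->
  forall G j z a b, j + G = k ->
    fr * A ^ d * (fr * A) ^ G <= z * ((A - B) * (fr - 1)) ^ G ->
    z <= a j -> G * P <= b q -> lister_forces k a b.
Proof.
move=> qd d0 /andP[B0 BA] fr0 hP G j z a b jG hz aj bq.
have Y1 : psum (geom A B d) d <= A ^ d.
  have := psum_geom (ltnW BA) (leqnn d); rewrite subnn muln1 => <-.
  by apply: leq_trans (leq_addr _ _); rewrite leq_pmull // subn_gt0.
have g0 : geom A B d 0 = B ^ d.-1 by rewrite /geom mul1n subn0.
apply: (@lift_chips k q d (geom A B d) (A - B) A fr P _ _ _ _ _ _ _ _ G j z) => //; try lia.
- move=> i id; have := psum_geom (ltnW BA) id.
  rewrite /geom mulnA -expnS; have -> : d - i.+1 = d.-1 - i by lia.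
  by lia.
- rewrite (@leq_trans (geom A B d 0)) //; first by rewrite g0 expn_gt0 B0.
  by rewrite /psum; case: (d) d0 => // d' _; rewrite big_ord_recl leq_addr.
- by rewrite g0; apply: leq_trans hP; rewrite leq_mul2l Y1 orbT.
- by apply: leq_trans hz; rewrite leq_mul2r leq_mul2l Y1 !orbT.
Qed.

(** * The uniform strategy and its lattice path *)

Definition presented M q (c : nat -> nat) i := if i < q then c i %/ M else 0.

(* Chips of one side when each round presents a fraction 1/M of every level
   below q: the path w lists, latest round first, whether this side advanced
   (true) or lost the presented chips (false).  Level q is never presented. *)
Fixpoint chips M q n (w : seq bool) : nat -> nat :=
  if w is b :: w' then
    let c := chips M q n w' in
    fun i => c i - presented M q c i + (if b then shift_up (presented M q c) i else 0)
  else at_origin n.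

Definition advances (w : seq bool) := count id w.
Definition losses (w : seq bool) := count negb w.

Lemma advances_negb w : advances (map negb w) = losses w.
Proof. by rewrite /advances count_map. Qed.

Lemma losses_negb w : losses (map negb w) = advances w.
Proof. by rewrite /losses count_map; apply: eq_count => -[]. Qed.

Lemma size_advances w : advances w + losses w = size w.
Proof. exact: count_predC. Qed.

Lemma advances_cons b w : advances (b :: w) = b + advances w.
Proof. by []. Qed.

Lemma losses_cons b w : losses (b :: w) = ~~ b + losses w.
Proof. by []. Qed.

Lemma presented_leq M q c i : presented M q c i <= c i.
Proof. by rewrite /presented; case: ifP => // _; apply: leq_div. Qed.

(** Painter's reply is the same for all levels, so one word describes the left side and its negation
    the right side. Every round increases one of two coordinates, so the larger one reaches [S]
    within [2 * S] rounds. *)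
Lemma forces_uniform k M q n S :
  (forall w, maxn (advances w) (losses w) = S ->
     lister_forces k (chips M q n w) (chips M q n (map negb w))) ->
  lister_forces k (at_origin n) (at_origin n).
Proof.
move=> K.
have main m : forall w, advances w <= S -> losses w <= S -> 2 * S - size w <= m ->
    lister_forces k (chips M q n w) (chips M q n (map negb w)).
  elim: m => [|m IH] w aS lS wm.
    by apply: K; move: (size_advances w) => sz; lia.
  case: (eqVneq (maxn (advances w) (losses w)) S) => [/K//|ne].
  have sz := size_advances w.
  apply: (@forces_round _ _ _ (presented M q (chips M q n w))
     (presented M q (chips M q n (map negb w)))) => [i|i||]; try exact: presented_leq.
  - apply: (@forces_mono _ (chips M q n (false :: w))
        (chips M q n (map negb (false :: w)))) => [i|i|]; rewrite /= ?addn0 //.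
    by apply: (IH (false :: w)); rewrite ?advances_cons ?losses_cons /=; lia.
  - apply: (@forces_mono _ (chips M q n (true :: w))
        (chips M q n (map negb (true :: w)))) => [i|i|]; rewrite /= ?addn0 //.
    by apply: (IH (true :: w)); rewrite ?advances_cons ?losses_cons /=; lia.
by apply: (main (2 * S) [::]) => //=; rewrite subn0.
Qed.

Fixpoint advances_at (g : nat -> nat -> bool) (w : seq bool) : nat :=
  if w is b :: w' then advances_at g w' + (b && g (advances w') (losses w')) else 0.

Lemma advances_at_cons g b w : advances_at g (b :: w) =
  advances_at g w + (b && g (advances w) (losses w)).
Proof. by []. Qed.

Lemma chips_top M q n v T (g : nat -> nat -> bool) w : 0 < q ->
  (forall w', size w' <= T -> g (advances w') (losses w') ->
     v <= chips M q n w' q.-1 %/ M) ->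
  size w <= T -> advances_at g w * v <= chips M q n w q.
Proof.
move=> q0 hv; elim: w => [|b w IH] //= sw; have {}IH := IH (ltnW sw).
rewrite {1}/presented ltnn subn0 mulnDl; apply: leq_add => //.
case: b => //=; case: (q) q0 hv => // q' _ hv /=.
rewrite /presented ltnSn; case gw: (g _ _); rewrite ?mul1n //.
by apply: hv => //; apply: ltnW.
Qed.

(** An advance keeps all chips within the levels up to [q], as level [q] is not presented; a loss
    removes at most a fraction [1 / M] of them. *)
Lemma chips_total M q n w :
  n * (M - 1) ^ losses w <= M ^ losses w * \sum_(i < q.+1) chips M q n w i.
Proof.
elim: w => [|b w IH].
  by rewrite /= !mul1n muln1 big_ord_recl leq_addr.
set c := chips M q n w in IH *.
have E : \sum_(i < q.+1) (c i - presented M q c i) + \sum_(i < q.+1) presented M q c i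
    = \sum_(i < q.+1) c i.
  by rewrite -big_split; apply: eq_bigr => i _; rewrite /= subnK // presented_leq.
have E2 : \sum_(i < q.+1) shift_up (presented M q c) i = \sum_(i < q.+1) presented M q c i.
  rewrite big_ord_recl big_ord_recr /= add0n {3}/presented ltnn addn0.
  by apply: eq_bigr => i _.
have E3 : M * \sum_(i < q.+1) presented M q c i <= \sum_(i < q.+1) c i.
  rewrite big_distrr; apply: leq_sum => i _; rewrite /presented.
  by case: ifP => _ /=; rewrite ?muln0 // mulnC; apply: leq_divM.
case: b => /=; rewrite /losses /= -/(losses w) -/c.
  by rewrite add0n big_split /= E2 E.
rewrite add1n !expnS mulnCA.
under eq_bigr do rewrite addn0.
apply: (@leq_trans ((M - 1) * (M ^ losses w * \sum_(i < q.+1) c i))).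
  by rewrite leq_mul2l IH orbT.
rewrite mulnCA [leqRHS]mulnAC [leqRHS]mulnC leq_mul2l; apply/orP; right.
move: E E3; set x := \sum_(i < q.+1) (_ - _); set p := \sum_(i < q.+1) presented _ _ _ _.
by move=> <- h; nia.
Qed.

Section Crossing.
Variables s0 S Lam : nat.

(** In the plane of the path, [x] counts advances and [y] losses. Only lagging is limited here:
    points far ahead are [abreast] too. *)
Definition abreast x y := [&& s0 <= x, x < S & y <= x + Lam].
Definition behind x y := [&& s0 <= x, x < S - Lam & x + Lam < y].
Definition ahead x y := [&& s0 + Lam <= x, x < S & y + Lam <= x].

(* An advance of one side made when it is more than Lam behind pairs with the
   advance of the other side at the abscissa shifted by Lam, made while that
   side was at least Lam ahead. *)
Lemma behind_ahead w : advances_at behind w +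
  (minn (losses w) S - (maxn (advances w) s0 + Lam)) <= advances_at ahead (map negb w).
Proof.
elim: w => [|b w]; first by rewrite /advances /losses /= min0n.
rewrite map_cons !advances_at_cons advances_negb losses_negb advances_cons losses_cons.
by rewrite /behind /ahead; case: b => /=; lia.
Qed.

Lemma abreast_behind w :
  minn (advances w) (S - Lam) - s0 <= advances_at abreast w + advances_at behind w.
Proof.
elim: w => [|b w]; first by rewrite /advances /losses /= min0n.
rewrite !advances_at_cons advances_cons.
by rewrite /abreast /behind; case: b => /=; lia.
Qed.

End Crossing.

(** Were [w] to end with few advances in the window, the other side would have been ahead too often,
    by [behind_ahead]. So [w] crosses most of the window, and few of its advances there are
    [behind], as each is paired with one where the other side is ahead. *)
Lemma many_abreast s0 H Lam w : 4 * Lam <= H -> 0 < H ->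
  maxn (advances w) (losses w) = s0 + H ->
  4 * advances_at (ahead s0 (s0 + H) Lam) w <= H ->
  4 * advances_at (ahead s0 (s0 + H) Lam) (map negb w) <= H ->
  H <= 4 * advances_at (abreast s0 (s0 + H) Lam) w.
Proof.
move=> LH H0 mS a1 a2.
have := behind_ahead s0 (s0 + H) Lam w.
have := behind_ahead s0 (s0 + H) Lam (map negb w).
have := abreast_behind s0 (s0 + H) Lam w.
rewrite advances_negb losses_negb (mapK negbK).
by lia.
Qed.

Lemma far_ahead s0 H w : losses w = s0 + H -> advances w <= s0 ->
  H <= 2 * advances_at (ahead s0 (s0 + H) (H %/ 2)) (map negb w).
Proof.
move=> lS aS; have := behind_ahead s0 (s0 + H) (H %/ 2) w; lia.
Qed.

(** * Choosability *)

Section Greedy.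
Variables (T : finType) (N : nat) (B : 'I_N -> {set T}).

(* The head of the sequence is treated last. *)
Fixpoint greedy (s : seq T) : {set T} :=
  if s is x :: s' then
    if [exists j, B j \subset x |: greedy s'] then greedy s' else x |: greedy s'
  else set0.

Lemma greedy_sub s x : x \in greedy s -> x \in s.
Proof.
elim: s => [|y s IH] /=; first by rewrite in_set0.
case: ifP => _; first by move/IH; rewrite inE => ->; rewrite orbT.
by rewrite in_setU1 inE => /predU1P[->|/IH ->]; rewrite ?eqxx ?orbT.
Qed.

Lemma greedy_avoids s j : (forall j, B j != set0) -> ~~ (B j \subset greedy s).
Proof.
move=> B0; elim: s => [|x s IH] /=; first by rewrite subset0.
by case: ifPn => // /existsPn.
Qed.

(** The witness [x] is the first colour of [A] to be treated; it was rejected because some [B j]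
    would have been exhausted. *)
Lemma greedy_missed (A : {set T}) s : (forall j, B j != set0) ->
  [disjoint A & greedy s] -> ~~ [disjoint A & s] ->
  exists s1 x s2 j, [/\ s = s1 ++ x :: s2, x \in A, x \in B j, [disjoint A & s2]
    & B j \subset x |: greedy s2].
Proof.
move=> B0; elim: s => [|y s IH] /=; first by move=> _ /pred0Pn[x]; rewrite /= in_nil andbF.
move=> dg; have [ds|nds] := boolP [disjoint A & s]; last first.
  move=> _; have {}dg : [disjoint A & greedy s].
    by move: dg; case: ifP => // _; rewrite setUC; apply: disjointWr; apply: subsetUl.
  have [s1 [x [s2 [j [-> xA xB ds2 Bj]]]]] := IH dg nds.
  by exists (y :: s1), x, s2, j.
rewrite disjoint_sym disjoint_cons disjoint_sym ds andbT negbK => yA.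
move: dg; case: ifPn => [/existsP[j Bj] _|_ /pred0P /(_ y)]; last first.
  by rewrite /= yA in_setU1 eqxx.
exists [::], y, s, j; split=> //.
apply: contraR (greedy_avoids s j B0) => yB.
apply/subsetP => z zB; have := subsetP Bj _ zB; rewrite in_setU1.
by case: eqP => // e; rewrite -e zB in yB.
Qed.

Lemma greedy_conflict (I : finType) (A : I -> {set T}) (w : T -> nat) :
  (forall i, A i != set0) -> (forall j, B j != set0) ->
  (exists X : {set T}, (forall i, ~~ [disjoint A i & X]) /\ forall j, ~~ (B j \subset X)) \/
  exists i j x, [/\ A i :&: B j = [set x], forall y, y \in A i -> w x <= w y
    & forall y, y \in B j -> w y <= w x].
Proof.
(* Decreasing order, since [greedy] starts at the end of the list: light colours are treated
   first. *)
move=> A0 B0; pose leT x y := w y <= w x.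
pose s := sort leT (enum T).
have sT x : x \in s by rewrite mem_sort mem_enum.
have us : uniq s by rewrite sort_uniq enum_uniq.
have ss : sorted leT s by apply: sort_sorted => x y; apply: leq_total.
have tr : transitive leT by move=> y x z yx zy; apply: leq_trans zy yx.
have [/existsP[i di]|/existsPn nd] := boolP [exists i, [disjoint A i & greedy s]]; last first.
  by left; exists (greedy s); split=> // j; apply: greedy_avoids.
right; have [x0 x0A] := set0Pn _ (A0 i).
have ns : ~~ [disjoint A i & s].
  by apply/pred0Pn; exists x0; rewrite /= x0A sT.
have [s1 [x [s2 [j [es xA xB ds2 Bj]]]]] := greedy_missed B0 di ns.
have before y : y \in s1 -> w x <= w y.
  move=> ys1; move: ss; rewrite es (sorted_pairwise tr) pairwise_cat /= allrel_consr.
  by case/and4P=> /andP[/allP h _] _ _ _; apply: h.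
have after y : y \in s2 -> w y <= w x.
  move=> ys2; move: ss; rewrite es (sorted_pairwise tr) pairwise_cat /=.
  by case/and4P=> _ _ /allP h _; apply: h.
have Bs2 y : y \in B j -> y = x \/ y \in s2.
  by move/(subsetP Bj); rewrite in_setU1 => /predU1P[->|/greedy_sub]; [left | right].
exists i, j, x; split.
- apply/setP => y; rewrite in_setI in_set1; apply/andP/eqP => [[yA /Bs2[//|ys2]]|-> //].
  by move/pred0P/(_ y): ds2; rewrite /= yA ys2.
- move=> y yA; have := sT y; rewrite es mem_cat inE => /or3P[/before//|/eqP->//|ys2].
  by move/pred0P/(_ y): ds2; rewrite /= yA ys2.
- by move=> y /Bs2[->|/after].
Qed.

End Greedy.

(** Independence of the weights, with probabilities cleared of denominators. *)
Lemma card_weights (T I : finType) (F : T -> {set I}) (D : {set T}) :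
  (forall x, x \notin D -> F x = setT) ->
  #|[set f : {ffun T -> I} | [forall x, f x \in F x]]| * #|I| ^ #|D|
    = #|I| ^ #|T| * \prod_(x in D) #|F x|.
Proof.
move=> FD; have -> : #|[set f : {ffun T -> I} | [forall x, f x \in F x]]| = \prod_x #|F x|.
  transitivity #|family (fun x => mem (F x))|.
    rewrite cardsE; apply: eq_card => f; apply/forallP/familyP => h x; exact: h.
  by rewrite card_family foldrE big_map big_enum.
rewrite (bigID (mem D)) /=.
have -> : \prod_(x | x \notin D) #|F x| = #|I| ^ #|~: D|.
  rewrite -prod_nat_const; apply: eq_big => x; first by rewrite inE.
  by move/FD->; rewrite cardsT.
by rewrite -mulnA -expnD [#|~: D| + _]addnC cardsC mulnC.
Qed.

Lemma card_ord_interval r x y : #|[set t : 'I_r | x <= t < y]| <= y - x.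
Proof.
rewrite cardE -(size_map val) -(size_iota x (y - x)); apply: uniq_leq_size.
  by rewrite map_inj_uniq ?enum_uniq //; apply: val_inj.
by move=> _ /mapP[t + ->]; rewrite mem_enum inE mem_iota /=; lia.
Qed.

(** A union bound over random weights below [r]. If the conflicting colour has one of the [a] top
    weights, a whole left list lies there ([E1]); if one of the [a] bottom weights, a whole right
    list does ([E2]); otherwise it has a middle weight [t] separating the two lists ([E3]). These
    events have probability at most [(a / r)^k], [(a / r)^k] and [m^(k-1) / r^(2k-1)]. *)
Lemma two_coloring (T : finType) N (A B : 'I_N -> {set T}) k r a m :
  (forall i, #|A i| = k) -> (forall j, #|B j| = k) -> 0 < k -> 2 * a <= r ->
  (forall t, t < r -> (r - t) * t.+1 <= m) ->
  2 * N * a ^ k * r ^ k.-1 + N ^ 2 * ((r - 2 * a) * m ^ k.-1) < r ^ (2 * k).-1 ->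
  exists X : {set T}, (forall i, ~~ [disjoint A i & X]) /\ forall j, ~~ (B j \subset X).
Proof.
move=> Ak Bk k0 ar rm lt; apply: contrapT => nX.
have r0 : 0 < r.
  case: (posnP r) => // r0; move: lt; rewrite r0 [ltnRHS]exp0n ?ltn0 //.
  by move: k0; clear; lia.
pose W := {ffun T -> 'I_r}.
pose E1 i := [set w : W | [forall x, w x \in
  (if x \in A i then [set t : 'I_r | r - a <= t] else setT)]].
pose E2 j := [set w : W | [forall x, w x \in (if x \in B j then [set t : 'I_r | t < a] else setT)]].
pose F3 i j x (t : 'I_r) y : {set 'I_r} := if y == x then [set t] else if y \in A i then
  [set u : 'I_r | t <= u] else if y \in B j then [set u : 'I_r | u <= t] else setT.
pose E3 i j x t := [set w : W | [forall y, w y \in F3 i j x t y]].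
pose mid (t : 'I_r) := a <= t < r - a.
have A0 i : A i != set0 by rewrite -card_gt0 Ak.
have B0 i : B i != set0 by rewrite -card_gt0 Bk.
have cover (w : W) : 1 <= \sum_i (w \in E1 i) + \sum_j (w \in E2 j) +
    \sum_i \sum_j \sum_(x | A i :&: B j == [set x]) \sum_(t | mid t) (w \in E3 i j x t).
  have [X|[i [j [x [ABx wA wB]]]]] := greedy_conflict (fun x => w x : nat) A0 B0; first by case: nX.
  case: (leqP (r - a) (w x)) => wx1.
    rewrite -addnA (bigD1 i) //= [_ \in _](_ : _ = true) //.
    rewrite inE; apply/forallP => y; case: ifP => yA; rewrite ?inE //.
    exact: leq_trans wx1 (wA y yA).
  case: (ltnP (w x) a) => wx2.
    rewrite addnAC addnC addnA (bigD1 j) //= [_ \in E2 _](_ : _ = true) //; last first.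
      rewrite inE; apply/forallP => y; case: ifP => yB; rewrite ?inE //.
      exact: leq_ltn_trans (wB y yB) wx2.
  rewrite addnC (bigD1 i) //= (bigD1 j) //= (bigD1 x) /= ?ABx ?eqxx //.
  rewrite (bigD1 (w x)) /=; last by rewrite /mid wx1 wx2.
  rewrite [_ \in E3 _ _ _ _](_ : _ = true) // inE; apply/forallP => y; rewrite /F3.
  case: eqP => [->|_]; first by rewrite inE.
  case: ifP => yA; first by rewrite inE wA.
  by case: ifP => yB; rewrite inE ?wB.
have cardE (E : {set W}) : \sum_(w : W) (w \in E : nat) = #|E|.
  by rewrite -sum1_card [RHS]big_mkcond; apply: eq_bigr => w _; case: (w \in E).
have total : r ^ #|T| <= \sum_i #|E1 i| + \sum_j #|E2 j| +
    \sum_i \sum_j \sum_(x | A i :&: B j == [set x]) \sum_(t | mid t) #|E3 i j x t|.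
  have -> : r ^ #|T| = \sum_(w : W) 1 by rewrite sum1_card card_ffun card_ord.
  apply: leq_trans (leq_sum _ (fun w _ => cover w)) _; rewrite !big_split /=.
  apply: eq_leq; congr (_ + _ + _).
  - by rewrite exchange_big; apply: eq_bigr => i _; apply: cardE.
  - by rewrite exchange_big; apply: eq_bigr => i _; apply: cardE.
  - rewrite exchange_big; apply: eq_bigr => i _; rewrite exchange_big; apply: eq_bigr => j _.
    rewrite exchange_big; apply: eq_bigr => x _; rewrite exchange_big; apply: eq_bigr => t _.
    exact: cardE.
have card_ge (c : nat) : c <= r -> #|[set t : 'I_r | r - c <= t]| <= c.
  move=> cr; apply: leq_trans (_ : r - (r - c) <= _); last by lia.
  apply: leq_trans (card_ord_interval r (r - c) r); apply: subset_leq_card.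
  by apply/subsetP => t; rewrite !inE ltn_ord andbT.
have card_lt (c : nat) : #|[set t : 'I_r | t < c]| <= c.
  rewrite -[leqRHS]subn0; apply: leq_trans (card_ord_interval r 0 c).
  by apply: subset_leq_card; apply/subsetP => t; rewrite !inE.
have e1 i : #|E1 i| * r ^ k <= r ^ #|T| * a ^ k.
  have := @card_weights _ _ (fun x => if x \in A i then [set t : 'I_r | r - a <= t] else setT) (A i) _.
  rewrite card_ord Ak => ->; last by move=> x /negbTE ->.
  rewrite leq_mul2l -(Ak i) -prod_nat_const; apply/orP; right.
  by apply: leq_prod => x ->; apply: card_ge; lia.
have e2 j : #|E2 j| * r ^ k <= r ^ #|T| * a ^ k.
  have := @card_weights _ _ (fun x => if x \in B j then [set t : 'I_r | t < a] else setT) (B j) _.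
  rewrite card_ord Bk => ->; last by move=> x /negbTE ->.
  rewrite leq_mul2l -(Bk j) -prod_nat_const; apply/orP; right.
  by apply: leq_prod => x ->; apply: card_lt.
have e3 i j x t : A i :&: B j = [set x] ->
    #|E3 i j x t| * r ^ (2 * k).-1 <= r ^ #|T| * m ^ k.-1.
  move=> ABx.
  have xAB : (x \in A i) && (x \in B j) by rewrite -in_setI ABx set11.
  case/andP: xAB => xA xB.
  have cAB : #|A i :|: B j| = (2 * k).-1 by rewrite cardsU ABx cards1 Ak Bk; lia.
  have := @card_weights _ _ (F3 i j x t) (A i :|: B j) _.
  rewrite card_ord cAB => ->; last first.
    move=> y; rewrite in_setU negb_or /F3 => /andP[yA yB].
    by case: eqP yA => [->|_ /negbTE ->]; rewrite ?xA // (negbTE yB).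
  rewrite leq_mul2l; apply/orP; right.
  rewrite (big_setID (A i)) /= setUK (big_setD1 x xA) /= {1}/F3 eqxx cards1 mul1n.
  apply: leq_trans (_ : (r - t) ^ k.-1 * t.+1 ^ k.-1 <= _); last first.
    by rewrite -expnMn; case: (k.-1) => // k'; rewrite leq_exp2r // rm.
  apply: leq_mul.
    have <- : #|A i :\ x| = k.-1 by have := cardsD1 x (A i); rewrite xA Ak => ->.
    rewrite -prod_nat_const; apply: leq_prod => y; rewrite !inE /F3 => /andP[/negbTE -> ->].
    rewrite -[leqLHS]/(#|[set u : 'I_r | t <= u]|).
    apply: leq_trans (card_ord_interval r t r); apply: subset_leq_card.
    by apply/subsetP => u; rewrite !inE ltn_ord andbT.
  have <- : #|(A i :|: B j) :\: A i| = k.-1.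
    by rewrite cardsD setUK cAB Ak; lia.
  rewrite -prod_nat_const; apply: leq_prod => y; rewrite !inE /F3 => /andP[/negbTE yA].
  rewrite yA /= => yB; rewrite yB ifN; last by apply: contraFN yA => /eqP ->.
  by apply: leq_trans (card_lt t.+1); apply: subset_leq_card; apply/subsetP => u; rewrite !inE.
have midc c : \sum_(t : 'I_r | mid t) c <= (r - 2 * a) * c.
  rewrite sum_nat_const leq_mul2r; apply/orP; right.
  have := card_ord_interval r a (r - a); rewrite cardsE /mid => h; apply: leq_trans h _; lia.
pose c3 := r ^ #|T| * ((r - 2 * a) * m ^ k.-1).
have e3s i j :
    (\sum_(x | A i :&: B j == [set x]) \sum_(t | mid t) #|E3 i j x t|) * r ^ (2 * k).-1 <= c3.
  have [x0 /eqP ABx|none] := pickP (fun x => A i :&: B j == [set x]); last first.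
    by rewrite big_pred0.
  rewrite (big_pred1 x0); last first.
    by move=> x; rewrite ABx /= (inj_eq set1_inj) eq_sym.
  rewrite big_distrl /= /c3 mulnCA; apply: leq_trans (midc _).
  by apply: leq_sum => t _; apply: e3.
have rT : 0 < r ^ #|T| by rewrite expn_gt0 r0.
have rk : r ^ (2 * k).-1 = r ^ k * r ^ k.-1 by rewrite -expnD; congr (_ ^ _); lia.
move: lt; rewrite ltnNge => /negP; apply; rewrite -(leq_pmul2l rT).
apply: leq_trans (leq_mul total (leqnn _)) _; rewrite !mulnDl.
have f1 (E : 'I_N -> {set W}) : (forall i, #|E i| * r ^ k <= r ^ #|T| * a ^ k) ->
    (\sum_i #|E i|) * r ^ (2 * k).-1 <= r ^ #|T| * (N * a ^ k * r ^ k.-1).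
  move=> hE; rewrite big_distrl /= (_ : _ * (_ * _ * _) = \sum_(i < N) r ^ #|T| * a ^ k * r ^ k.-1); last first.
    by rewrite sum_nat_const card_ord -!mulnA mulnCA.
  by apply: leq_sum => i _; rewrite rk mulnA leq_mul2r hE orbT.
have f3 : (\sum_i \sum_j \sum_(x | A i :&: B j == [set x]) \sum_(t | mid t) #|E3 i j x t|)
    * r ^ (2 * k).-1 <= N ^ 2 * c3.
  rewrite big_distrl /= (_ : N ^ 2 * c3 = \sum_(i < N) \sum_(j < N) c3); last first.
    by rewrite !sum_nat_const card_ord mulnA.
  by apply: leq_sum => i _; rewrite big_distrl; apply: leq_sum => j _; apply: e3s.
apply: leq_trans (leq_add (leq_add (f1 _ e1) (f1 _ e2)) f3) _.
by rewrite /c3; lia.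
Qed.

(** * Elementary inequalities between powers *)

Lemma leq_expl (a b x : nat) : (x <= 2 ^ a)%N -> (a <= b)%N -> (x <= 2 ^ b)%N.
Proof. by move=> xa ab; apply: leq_trans xa _; rewrite leq_exp2l. Qed.

Lemma leqD_expl (a b x y : nat) : (x <= 2 ^ a)%N -> (y <= 2 ^ a)%N -> (a < b)%N ->
  (x + y <= 2 ^ b)%N.
Proof.
move=> xa ya ab; apply: leq_trans (_ : 2 ^ a.+1 <= _)%N; last by rewrite leq_exp2l.
by rewrite expnS mul2n -addnn leq_add.
Qed.

Lemma leqM_expl (a b c x y : nat) : (x <= 2 ^ a)%N -> (y <= 2 ^ b)%N -> (a + b <= c)%N ->
  (x * y <= 2 ^ c)%N.
Proof.
move=> xa yb ab; apply: leq_trans (_ : 2 ^ (a + b) <= _)%N; last by rewrite leq_exp2l.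
by rewrite expnD leq_mul.
Qed.

Lemma leq_expn_div l : (1000 <= l)%N -> (l <= 2 ^ (l %/ 10))%N.
Proof.
elim/ltn_ind: l => l IH l1; case: (ltnP l 1010) => l2.
  apply: (@leq_trans (2 ^ 10)); first by rewrite -ltnS (leq_trans l2).
  by rewrite leq_exp2l //; lia.
have := IH (l - 10)%N ltac:(lia) ltac:(lia).
rewrite (_ : l %/ 10 = ((l - 10) %/ 10).+1)%N; last by lia.
by rewrite expnS; lia.
Qed.

Lemma leq_expn2r x y c : (x <= y)%N -> (x ^ c <= y ^ c)%N.
Proof. by case: c => // c; rewrite leq_exp2r. Qed.

Lemma expn65_le c : (65 ^ (60 * c) <= 2 ^ (362 * c))%N.
Proof. by rewrite !expnM; apply: leq_expn2r; lia. Qed.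

(** Bernoulli's inequality gives [((a + b) / a)^m >= 2], and this is used [t] times. *)
Lemma leq_double_expn (a b m t G : nat) : (0 < m)%N -> (a <= m * b)%N -> (m * t <= G)%N ->
  (2 ^ t * a ^ G <= (a + b) ^ G)%N.
Proof.
move=> m0 amb mtG.
have main c : (a ^ c.+1 + c.+1 * b * a ^ c <= (a + b) ^ c.+1)%N.
  elim: c => [|c IH]; first by rewrite !expn1 expn0 mul1n muln1.
  rewrite expnS (leq_trans _ (leq_mul (leqnn (a + b)%N) IH)) //.
  by rewrite !expnS; set x := (a ^ c)%N; nia.
have dbl : (2 * a ^ m <= (a + b) ^ m)%N.
  case: m m0 amb {mtG} => // c _ amb.
  by apply: leq_trans (main c); rewrite mul2n -addnn leq_add2l expnS leq_mul2r amb orbT.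
rewrite -(subnK mtG) !expnD mulnCA; apply: leq_mul.
  by apply: leq_expn2r; rewrite leq_addr.
by rewrite !expnM -expnMn leq_expn2r.
Qed.

Lemma mul60_le l c : (c <= 2 ^ l -> 60 * l + c <= 2 ^ (l + 7))%N.
Proof.
have := ltn_expl l (isT : (1 < 2)%N); rewrite expnD; set x := (2 ^ l)%N.
by rewrite (_ : 2 ^ 7 = 128)%N //; lia.
Qed.

Lemma choosable_two_coloring N k r a m : 0 < k -> 2 * a <= r ->
  (forall t, t < r -> (r - t) * t.+1 <= m) ->
  2 * N * a ^ k * r ^ k.-1 + N ^ 2 * ((r - 2 * a) * m ^ k.-1) < r ^ (2 * k).-1 ->
  choosable (biclique N N) k.
Proof.
move=> k0 ar rm lt C L Lk.
pose U : {fset C} := (\bigcup_(v <- enum (biclique N N)) L v)%fset.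
have LU v : (L v `<=` U)%fset.
  by apply: bigfcup_sup => //; rewrite mem_enum.
pose D v : {set U} := [set x | val x \in L v].
have Dk v : #|D v| = k.
  rewrite -(Lk v) cardE -(size_map val); apply/perm_size/uniq_perm.
  - by rewrite map_inj_uniq ?enum_uniq //; apply: val_inj.
  - exact: fset_uniq.
  move=> y; apply/mapP/idP => [[x + ->]|yL]; first by rewrite mem_enum inE.
  exists [` fsubsetP (LU v) _ yL]%fset => //.
  by rewrite mem_enum inE.
have [X [XA XB]] := @two_coloring U N (fun i => D (inl i)) (fun j => D (inr j))
  k r a m (fun i => Dk _) (fun i => Dk _) k0 ar rm lt.
have /boolp.choice[c cP] : forall v, exists x : U,
    x \in D v /\ (x \in X) = (if v is inl _ then true else false).
  case=> i; first by have /pred0Pn[x /andP[xD xX]] := XA i; exists x.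
  by have /subsetPn[x xD /negbTE xX] := XB i; exists x.
exists (fun v => val (c v)); split=> [v|u v uv /val_inj e].
  by have [] := cP v; rewrite inE.
have [_ hu] := cP u; have [_ hv] := cP v; move: hu; rewrite e hv.
by case: u v uv {e hv} => [u|u] [v|v].
Qed.

Lemma double_interval_le h t : t < 2 * h -> (2 * h - t) * t.+1 <= h * h.+1.
Proof.
move=> th; case: (leqP t h) => le.
  have -> : 2 * h - t = h + (h - t) by lia.
  by have := subnK le; move: (h - t) => d <-; nia.
have e := subnK (ltnW le); rewrite -e in th *; move: (t - h) le th => d _ dh.
have -> : 2 * h - (d + h) = h - d by lia.
have {e}e := subnK (ltnW (_ : d < h)); rewrite -e; last by lia.
by move: (h - d) => f; nia.
Qed.

(** From [(1 - p / h) (1 + 1 / h)^p <= 1], taken at [p = m <= h / 2]. *)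
Lemma succ_expn_le h m : 2 * m <= h -> 0 < h -> h.+1 ^ m <= 2 * h ^ m.
Proof.
move=> mh h0.
have main : forall p, p <= h -> (h - p) * h.+1 ^ p <= h ^ p.+1.
  elim=> [|p IH] ph; first by rewrite subn0 expn0 muln1 expn1.
  rewrite expnS [leqRHS]expnS; apply: leq_trans (leq_mul (leqnn h) (IH (ltnW ph))).
  rewrite mulnA mulnA leq_mul2r; apply/orP; right; nia.
rewrite -(leq_pmul2l h0); have := main m ltac:(lia); rewrite expnS => h1.
have : h * h.+1 ^ m <= 2 * (h - m) * h.+1 ^ m by rewrite leq_mul2r; apply/orP; right; lia.
by rewrite -mulnA; lia.
Qed.

Lemma choosable_biclique l k N : 1000 <= l -> 2 ^ (20 * l - 1) <= k -> k <= 2 ^ (20 * l + 20) ->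
  N <= 2 ^ (k + 9 * l - 3) -> choosable (biclique N N) k.
Proof.
(* The middle range has relative width [b / h = 2^(- 18 l)]. This compensates the factor [2^(18 l)]
   in [N ^ 2], and the range is still wide enough for [(1 - b / h)^k <= 2^(- 9 l)], because
   [k >= 2^(20 l - 1)]. *)
move=> l1 kl ku hN; set h := 2 ^ (20 * l + 22).
pose b := 2 ^ (2 * l + 22); pose a := h - b.
have k0 : 0 < k by apply: leq_trans kl; rewrite expn_gt0.
have h0 : 0 < h by rewrite expn_gt0.
have bh : b <= h by rewrite leq_exp2l //; move: l1; clear; lia.
have hk : 2 * k <= h.
  rewrite /h (_ : 20 * l + 22 = (20 * l + 20).+2); last by clear; lia.
  by rewrite expnS leq_mul2l expnS; apply/orP; right; apply: leq_trans ku _; rewrite leq_pmull.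
have aE : (2 * h) - 2 * a = 2 * b by rewrite /a; move: bh; clear; lia.
apply: (@choosable_two_coloring N k (2 * h) a (h * h.+1)) => //.
- by rewrite leq_mul2l leq_subr orbT.
- by move=> t; apply: double_interval_le.
rewrite aE.
have ll := ltn_expl l (isT : 1 < 2).
set R := (2 * h) ^ (2 * k).-1.
have RE : R = (2 * h) ^ k * (2 * h) ^ k.-1 by rewrite -expnD; congr (_ ^ _); move: k0; clear; lia.
have RE2 : R = 2 ^ (2 * k).-1 * (h ^ k.-1 * h ^ k.-1 * h).
  rewrite /R expnMn -expnD -expnSr; congr (_ * _ ^ _); move: k0; clear; lia.
have first : 4 * (2 * N * a ^ k * (2 * h) ^ k.-1) <= R.
  have decay : 2 ^ (9 * l) * a ^ k <= h ^ k.
    rewrite -[in leqRHS](subnK bh); apply: (@leq_double_expn a b (2 ^ (18 * l))).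
    - by rewrite expn_gt0.
    - apply: leq_trans (leq_subr _ _) _; rewrite /b -expnD /h leq_exp2l //; clear; lia.
    - apply: leq_trans kl; apply: (@leqM_expl (18 * l) (l + 4)) => //; last by move: l1; clear; lia.
      by rewrite expnD; move: ll; rewrite (_ : 2 ^ 4 = 16) //; clear; lia.
  rewrite RE !mulnA leq_mul2r; apply/orP; right; rewrite expnMn.
  apply: (@leq_trans (2 ^ (k + 9 * l) * a ^ k)).
    rewrite leq_mul2r; apply/orP; right.
    rewrite (_ : k + 9 * l = 3 + (k + 9 * l - 3)); last by move: l1; clear; lia.
    by rewrite expnD leq_mul2l.
  by rewrite expnD -mulnA leq_mul2l decay orbT.
have second : 4 * (N ^ 2 * (2 * b * (h * h.+1) ^ k.-1)) <= R.
  have hh : h.+1 ^ k.-1 <= 2 * h ^ k.-1.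
    by apply: succ_expn_le => //; move: hk; clear; lia.
  have NN : N ^ 2 <= 2 ^ (2 * k + 18 * l - 6).
    rewrite -mulnn; apply: (@leqM_expl (k + 9 * l - 3) (k + 9 * l - 3)) => //.
    by move: l1; clear; lia.
  rewrite RE2 expnMn.
  apply: (@leq_trans (2 ^ (2 * k + 20 * l + 20) * (h ^ k.-1 * h ^ k.-1))).
    apply: (@leq_trans (2 ^ 2 * (2 ^ (2 * k + 18 * l - 6) * (2 * b * (h ^ k.-1 * (2 * h ^ k.-1)))))).
      by rewrite leq_mul2l; apply/orP; right; apply: leq_mul => //; rewrite !leq_mul2l hh !orbT.
    have -> : 2 ^ 2 * (2 ^ (2 * k + 18 * l - 6) * (2 * b * (h ^ k.-1 * (2 * h ^ k.-1)))) =
       2 ^ 2 * 2 ^ (2 * k + 18 * l - 6) * 2 ^ 2 * b * (h ^ k.-1 * h ^ k.-1).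
      by rewrite (_ : 2 ^ 2 = 4) //; clear; lia.
    rewrite leq_mul2r; apply/orP; right; rewrite /b -!expnD leq_exp2l //.
    by move: l1; clear; lia.
  rewrite [leqLHS]mulnC [leqRHS]mulnCA leq_mul2l; apply/orP; right.
  rewrite /h -expnD leq_exp2l //; move: k0; clear; lia.
have R0 : 0 < R by rewrite expn_gt0 muln_gt0 h0.
have add_lt x y z : 4 * x <= z -> 4 * y <= z -> 0 < z -> x + y < z by clear; lia.
exact: add_lt.
Qed.

(** * Estimates for the uniform strategy *)

From mathcomp Require Import classical_sets topology normedtype sequences derive realfun.

Import numFieldNormedType.Exports.
Local Open Scope ring_scope.

Section Cayley.
Local Open Scope classical_set_scope.

(** The difference of the two sides vanishes at 0 and has derivative [y (expR y - expR (- y))]. *)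
Lemma expR_cayley (R : realType) (y : R) : 0 <= y -> (1 - y) * expR y <= (1 + y) * expR (- y).
Proof.
move=> y0.
pose f := fun x : R => (1 + x) * expR (- x) - (1 - x) * expR x.
have df (x : R) : is_derive x 1 f (x * (expR x - expR (- x))).
  by rewrite /f; apply: is_derive_eq; rewrite /GRing.scale /=; ring.
have fc : {within `[0, y], continuous f}.
  by apply: derivable_within_continuous => x _; apply: ex_derive.
have f0 : f 0 = 0 by rewrite /f oppr0 expR0; ring.
rewrite -subr_ge0 -/(f y) -f0.
apply: (@ger0_derive1_ndecr R f 0 y (fun x _ => @ex_derive _ _ _ _ _ _ _ (df x))) => // x.
rewrite in_itv /= => /andP[x0 _]; rewrite derive1E (@derive_val _ _ _ _ _ _ _ (df x)).
by rewrite mulr_ge0 ?(ltW x0) // subr_ge0 ler_expR; lra.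
Qed.

End Cayley.

Section Estimates.
Variable R : realType.
Implicit Types (u e y : R).

Lemma expR_subsqr_le u : 0 <= u -> expR (u - u ^+ 2) <= 1 + u.
Proof.
move=> u0; have u1 : 0 < 1 + u by lra.
apply: (@le_trans _ _ (expR (u / (1 + u)))).
  rewrite ler_expR ler_pdivlMr //.
  have : 0 <= u ^+ 3 by rewrite exprn_ge0.
  by rewrite !exprS expr0; lra.
have := expR_ge1Dx (- (u / (1 + u))); rewrite expRN.
have -> : 1 + - (u / (1 + u)) = (1 + u)^-1 by field; lra.
by rewrite lef_pV2 // posrE ?expR_gt0.
Qed.

Lemma expR_addsqr_le e : 0 <= e <= 2^-1 -> expR (- (e + 2 * e ^+ 2)) <= 1 - e.
Proof.
case/andP=> e0 e1; have e2 : 0 < 1 - e by lra.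
have e3 : 0 <= e ^+ 2 by rewrite exprn_ge0.
have -> : 1 - e = (1 + e / (1 - e))^-1 by field; lra.
rewrite expRN lef_pV2 ?posrE ?expR_gt0 //; last first.
  by have : 0 <= e / (1 - e) by [rewrite divr_ge0 // ltW]; lra.
apply: le_trans (expR_ge1Dx _) _; rewrite ler_expR ler_pdivrMr //.
have : e * e ^+ 2 <= 2^-1 * e ^+ 2 by rewrite ler_wpM2r.
by lra.
Qed.

(** This is [expR_cayley] at [y = 1 / (2 n + 1)], where [(1 + y) / (1 - y) = (n + 1) / n]. *)
Lemma expR2_le n : (0 < n)%N ->
  expR 2 * n%:R ^+ (2 * n).+1 <= n.+1%:R ^+ (2 * n).+1 :> R.
Proof.
move=> n0; have n0' : 0 < n%:R :> R by rewrite ltr0n.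
pose y : R := (2 * n).+1%:R^-1.
have y0 : 0 < y by rewrite invr_gt0 ltr0n.
have yE : y * (2 * n%:R + 1) = 1.
  by rewrite /y -natrM -[1]/(1%:R) -natrD addn1 mulVf // pnatr_eq0.
have -> : (2 : R) = (2 * n).+1%:R * (2 * y).
  by rewrite -[(2 * n).+1]addn1 natrD natrM mulrCA (mulrC _ y) yE mulr1.
rewrite expRM_natl -exprMn lerXn2r ?nnegrE ?mulr_ge0 ?expR_ge0 //.
have : (1 - y) * expR (2 * y) <= 1 + y.
  have := expR_cayley (ltW y0); rewrite -(ler_pM2r (expR_gt0 y)).
  rewrite -[X in _ <= X]mulrA -[X in X <= _]mulrA -!expRD addNr expR0 mulr1.
  by have -> : y + y = 2 * y by ring.
move=> h; have n2 : 0 <= 2 * n%:R + 1 :> R by lra.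
have := ler_wpM2l n2 h; rewrite mulrA.
have -> : (2 * n%:R + 1) * (1 - y) = 2 * n%:R by rewrite mulrBr mulr1 [_ * y]mulrC yE; ring.
have -> : (2 * n%:R + 1) * (1 + y) = 2 * n.+1%:R.
  by rewrite mulrDr mulr1 [_ * y]mulrC yE -[n.+1]addn1 natrD; ring.
by rewrite -mulrA ler_pM2l // mulrC.
Qed.

(** Stirling's upper bound [n! <= e sqrt(n) (n / e)^n], squared to avoid the root; [expR2_le] is the
    induction step. *)
Lemma factorial_le_sqr n : (0 < n)%N ->
  (n`!%:R * expR n%:R) ^+ 2 <= (expR 1 * n%:R ^+ n) ^+ 2 * n%:R :> R.
Proof.
elim: n => // -[_ _|n IH _]; first by rewrite mul1r expr1n !mulr1.
have {}IH := IH isT.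
set m := n.+1 in IH *.
have m0 : (0 : R) <= m.+1%:R by [].
have h := @expR2_le m isT.
rewrite factS natrM -[X in expR X%:R]addn1 natrD expRD.
have -> : (m.+1%:R * m`!%:R * (expR m%:R * expR 1)) ^+ 2 =
  (m.+1%:R * expR 1) ^+ 2 * (m`!%:R * expR m%:R) ^+ 2 :> R by ring.
apply: le_trans (ler_wpM2l _ IH) _; first exact: sqr_ge0.
have -> : (m.+1%:R * expR 1) ^+ 2 * ((expR 1 * m%:R ^+ m) ^+ 2 * m%:R) =
  (m.+1%:R * expR 1) ^+ 2 * (expR 2 * m%:R ^+ (2 * m).+1) :> R.
  have -> : expR 2 = expR 1 ^+ 2 :> R by rewrite -expRM_natl mulr1.
  by rewrite [_ ^+ (2 * m).+1]exprS [(2 * m)%N]mulnC exprM; ring.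
apply: le_trans (ler_wpM2l _ h) _; first exact: sqr_ge0.
rewrite le_eqVlt; apply/orP; left; apply/eqP.
by rewrite [_ ^+ (2 * m).+1]exprS [(2 * m)%N]mulnC exprM [_ ^+ m.+1]exprS; ring.
Qed.

Lemma factorial_le n r : (0 < n)%N -> 0 < r -> n%:R <= r ^+ 2 ->
  n`!%:R <= expR 1 * r * n%:R ^+ n * expR (- n%:R) :> R.
Proof.
move=> n0 r0 nr; rewrite expRN ler_pdivlMr ?expR_gt0 //.
rewrite -(@ler_pXn2r _ 2) ?nnegrE ?mulr_ge0 ?exprn_ge0 ?ler0n ?(ltW r0) ?expR_ge0 //.
apply: le_trans (factorial_le_sqr n0) _.
have -> : (expR 1 * r * n%:R ^+ n) ^+ 2 = (expR 1 * n%:R ^+ n) ^+ 2 * r ^+ 2 by ring.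
by rewrite ler_wpM2l // sqr_ge0.
Qed.

Lemma ffact_ge s i : (i <= s)%N -> ((s - i) ^ i <= s ^_ i)%N.
Proof.
move=> si; rewrite ffact_prod.
have -> : ((s - i) ^ i = \prod_(j < i) (s - i))%N by rewrite prod_nat_const card_ord.
by apply: leq_prod => j _; apply: leq_sub2l; apply: ltnW.
Qed.

(** Here [dl] measures the offset of the diagonal point [(s, s)] from the peak of level [i]. By
    Stirling and [(s - i) / M = (i + dl) / 2], the factor [(1 + dl / i)^i >= expR (dl - dl^2 / i)]
    meets [(1 - 1 / M)^(2 s)], which is about [expR (- i - dl)]; the linear terms cancel and a
    Gaussian loss [dl^2 / i] remains. *)
Lemma binomial_ge (i s M : nat) (dl r : R) : (0 < i <= s)%N -> (1 < M)%N -> 0 <= dl ->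
  2 * (s%:R - i%:R) = M%:R * (i%:R + dl) -> 0 < r -> i%:R <= r ^+ 2 ->
  2^-1 ^+ i * expR (- (dl ^+ 2 / i%:R + 1 + 2 * i%:R / M%:R + 4 * s%:R / M%:R ^+ 2)) / r <=
  'C(s, i)%:R * M%:R^-1 ^+ i * (1 - M%:R^-1) ^+ (2 * s - i) :> R.
Proof.
move=> /andP[i0 si] M1 dl0 sE r0 ir.
have i0' : 0 < i%:R :> R by rewrite ltr0n.
have M0 : 0 < M%:R :> R by rewrite ltr0n (ltnW M1).
set e : R := M%:R^-1.
have e0 : 0 < e by rewrite invr_gt0.
have e1 : e <= 2^-1 by rewrite lef_pV2 ?posrE // ler_nat.
have f0 : 0 < i`!%:R :> R by rewrite ltr0n fact_gt0.
rewrite ler_pdivrMr // -(ler_pM2l f0).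
apply: (@le_trans _ _ (r * (((s - i)%N%:R * e) ^+ i * (1 - e) ^+ (2 * s)))); last first.
  have -> : i`!%:R * ('C(s, i)%:R * e ^+ i * (1 - e) ^+ (2 * s - i) * r) =
    r * (('C(s, i) * i`!)%N%:R * e ^+ i * (1 - e) ^+ (2 * s - i)) by rewrite natrM; ring.
  rewrite ler_wpM2l ?(ltW r0) // bin_ffact exprMn -natrX.
  apply: ler_pM; rewrite ?mulr_ge0 ?exprn_ge0 ?ler0n ?(ltW e0) //; try lra.
    by rewrite ler_pM2r ?exprn_gt0 // ler_nat ffact_ge.
  by rewrite ler_wiXn2l ?leq_subr //; lra.
have -> : (s - i)%N%:R * e = 2^-1 * (i%:R * (1 + dl / i%:R)).
  have -> : (s - i)%N%:R = 2^-1 * (M%:R * (i%:R + dl)) by rewrite natrB // -sE; field.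
  by rewrite /e; field; rewrite !gt_eqF.
have h1 : expR (dl - dl ^+ 2 / i%:R) <= (1 + dl / i%:R) ^+ i.
  have -> : dl - dl ^+ 2 / i%:R = i%:R * (dl / i%:R - (dl / i%:R) ^+ 2) by field; rewrite gt_eqF.
  rewrite expRM_natl lerXn2r ?nnegrE ?expR_ge0 ?addr_ge0 ?divr_ge0 ?ler0n //.
  by apply: expR_subsqr_le; rewrite divr_ge0 ?ler0n.
have h2 : expR (- (2 * s%:R * e + 4 * s%:R * e ^+ 2)) <= (1 - e) ^+ (2 * s).
  have -> : - (2 * s%:R * e + 4 * s%:R * e ^+ 2) = (2 * s)%N%:R * (- (e + 2 * e ^+ 2)).
    by rewrite natrM; ring.
  rewrite expRM_natl lerXn2r ?nnegrE ?expR_ge0 //; first by lra.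
  by apply: expR_addsqr_le; rewrite (ltW e0).
rewrite !exprMn.
apply: (@le_trans _ _ (r * (2^-1 ^+ i * (i%:R ^+ i * expR (dl - dl ^+ 2 / i%:R)) *
    expR (- (2 * s%:R * e + 4 * s%:R * e ^+ 2))))); last first.
  rewrite ler_wpM2l ?(ltW r0) // ler_pM ?mulr_ge0 ?exprn_ge0 ?expR_ge0 ?ler0n ?invr_ge0 //.
  by rewrite ler_wpM2l ?exprn_ge0 ?invr_ge0 // ler_wpM2l ?exprn_ge0.
apply: le_trans (ler_wpM2r _ (factorial_le i0 r0 ir)) _.
  by rewrite mulr_ge0 ?exprn_ge0 ?expR_ge0 ?invr_ge0.
rewrite le_eqVlt; apply/orP; left; apply/eqP.
have -> : 2 * s%:R * e = i%:R + dl + 2 * i%:R / M%:R.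
  rewrite (_ : 2 * s%:R = 2 * (s%:R - i%:R) + 2 * i%:R); last by ring.
  by rewrite sE /e; field; rewrite gt_eqF.
have -> : 4 * s%:R / M%:R ^+ 2 = 4 * s%:R * e ^+ 2 by rewrite /e exprVn.
set X := 2 * i%:R / M%:R; set Y := 4 * s%:R * e ^+ 2; set Z := dl ^+ 2 / i%:R.
have E : expR 1 * expR (- i%:R) * expR (- (Z + 1 + X + Y)) =
   expR (dl - Z) * expR (- (i%:R + dl + X + Y)) by rewrite -!expRD; congr expR; ring.
transitivity (r * i%:R ^+ i * 2^-1 ^+ i * (expR 1 * expR (- i%:R) * expR (- (Z + 1 + X + Y)))).
  by ring.
by rewrite E; ring.
Qed.

(** The content of level [i] if nothing were rounded; it depends on the path only through its
    endpoint. *)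
Definition ideal_chips (M n x y i : nat) : R :=
  n%:R * ('C(x, i)%:R * M%:R^-1 ^+ i * (1 - M%:R^-1) ^+ (x + y - i)).

(* The error term comes from rounding: a round creates an error of at most 1,
   and the errors already made are averaged. *)
Lemma chips_ge M q n w i : (0 < M)%N -> (i < q)%N ->
  ideal_chips M n (advances w) (losses w) i <= (chips M q n w i)%:R + (size w)%:R.
Proof.
move=> M0; have M0' : 0 < M%:R :> R by rewrite ltr0n.
rewrite /ideal_chips; set e : R := M%:R^-1.
have e0 : 0 < e by rewrite invr_gt0.
have e1 : e <= 1 by rewrite invf_le1 // ler1n.
elim: w i => [|b w IH] i iq.
  rewrite /= /at_origin /advances /losses /= addr0 sub0n.
  by case: i iq => [|i] _ /=; rewrite ?bin0 ?expr0 ?bin0n ?mul0r ?mulr0 // !mulr1.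
set c := chips M q n w in IH *.
have pE j : (j < q)%N -> (c j)%:R * e - 1 <= (presented M q c j)%:R <= (c j)%:R * e.
  move=> jq; rewrite /presented jq; apply/andP; split.
    rewrite lerBlDr ler_pdivrMr // natr1 -natrM ler_nat.
    by rewrite ltnW // ltn_ceil.
  by rewrite ler_pdivlMr // -natrM ler_nat leq_divM.
rewrite advances_cons losses_cons.
have -> : chips M q n (b :: w) i = (c i - presented M q c i +
  (if b then shift_up (presented M q c) i else 0))%N by [].
rewrite [size _]/=.
set x := advances w in IH *; set y := losses w in IH *.
have /andP[p1 p2] := pE _ iq; have cx := IH _ iq.
rewrite natrD natrB ?presented_leq // -[(size w).+1]addn1 natrD.
have D0 : 0 <= (1 - e) by lra.
have step : (1 - e) * (n%:R * ('C(x, i)%:R * e ^+ i * (1 - e) ^+ (x + y - i))) <=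
    (c i)%:R - (presented M q c i)%:R + (1 - e) * (size w)%:R.
  by apply: le_trans (ler_wpM2l D0 cx) _; rewrite mulrDr; lra.
have sz : 0 <= (size w)%:R * e by rewrite mulr_ge0 ?ler0n ?(ltW e0).
case: b => /=.
  rewrite add0n.
  case: i iq cx p1 p2 step => [|i] iq cx p1 p2 step.
    rewrite !bin0 !expr0 /= subn0 in step *.
    by move: step; rewrite add1n subn0 !mul1r exprS; lra.
  have /andP[p3 p4] := pE _ (ltnW iq); have cx' := IH _ (ltnW iq).
  have step' : e * (n%:R * ('C(x, i)%:R * e ^+ i * (1 - e) ^+ (x + y - i))) <=
    (presented M q c i)%:R + 1 + e * (size w)%:R.
    by apply: le_trans (ler_wpM2l (ltW e0) cx') _; rewrite mulrDr; lra.
  (* Pascal's rule: the chips of level [i.+1] either stayed there or came up from level [i]. *)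
  suff -> : n%:R * ('C(1 + x, i.+1)%:R * e ^+ i.+1 * (1 - e) ^+ (1 + x + y - i.+1)) =
    (1 - e) * (n%:R * ('C(x, i.+1)%:R * e ^+ i.+1 * (1 - e) ^+ (x + y - i.+1))) +
    e * (n%:R * ('C(x, i)%:R * e ^+ i * (1 - e) ^+ (x + y - i))).
    by rewrite /=; lra.
  rewrite add1n binS natrD addSn subSS.
  case: (leqP i.+1 x) => ix.
    have -> : (x + y - i = (x + y - i.+1).+1)%N by rewrite subnSK // ltn_addr.
    by rewrite !exprS; ring.
  by rewrite (bin_small ix) mulr0n exprS; ring.
rewrite add0n addr0.
case: (leqP i x) => ix; last first.
  have : (presented M q c i)%:R <= (c i)%:R :> R by rewrite ler_nat presented_leq.
  have : 0 <= (size w)%:R :> R by rewrite ler0n.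
  by rewrite bin_small // !mul0r mulr0; lra.
have -> : (x + (1 + y) - i = (x + y - i).+1)%N.
  by rewrite addnCA subSn // (leq_trans ix (leq_addr _ _)).
by move: step; rewrite exprS; lra.
Qed.

End Estimates.

(** * Numerical bounds and the last [60 * l] levels *)

Section Numerics.
Variable R : realType.

Lemma expRN_ge m : 2^-1 ^+ (2 * m) <= expR (- m%:R) :> R.
Proof.
have h : 2^-1 <= expR (- 2^-1) :> R.
  by have := @expR_ge1Dx R (- 2^-1); lra.
have -> : - m%:R = (2 * m)%:R * (- 2^-1) :> R by rewrite natrM; field.
by rewrite expRM_natl lerXn2r ?nnegrE ?expR_ge0 // invr_ge0.
Qed.

Lemma bernoulli (x : R) m : 0 <= x -> 1 + m%:R * x <= (1 + x) ^+ m.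
Proof.
move=> x0; elim: m => [|m IH]; first by rewrite mul0r addr0.
rewrite exprSr; have x1 : 0 <= 1 + x by lra.
apply: le_trans (ler_wpM2r x1 IH).
have : 0 <= m%:R * (x * x) by rewrite !mulr_ge0 ?ler0n.
by rewrite -natr1; lra.
Qed.

Lemma one_sub_inv_ge (M m : nat) : (1 < M)%N ->
  expR (- (m%:R / M%:R + 2 * m%:R / M%:R ^+ 2)) <= (1 - M%:R^-1) ^+ m :> R.
Proof.
move=> M1; set e : R := M%:R^-1.
have e0 : 0 <= e by rewrite invr_ge0.
have e1 : e <= 2^-1 by rewrite lef_pV2 ?posrE ?ltr0n ?(ltnW M1) // ler_nat.
have -> : - (m%:R * e + 2 * m%:R / M%:R ^+ 2) = m%:R * (- (e + 2 * e ^+ 2)).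
  by rewrite -exprVn -/e; ring.
rewrite expRM_natl lerXn2r ?nnegrE ?expR_ge0 //; first by lra.
by apply: expR_addsqr_le; rewrite e0.
Qed.

Lemma half_pow_mul a b : (b <= a)%N -> 2^-1 ^+ b * 2 ^+ a = 2 ^+ (a - b) :> R.
Proof.
move=> ba; rewrite -{1}(subnK ba) exprD mulrCA -exprMn mulVf ?expr1n ?mulr1 //.
by rewrite pnatr_eq0.
Qed.

Lemma ideal_chips_mono M n x y y' i : (0 < M)%N -> (i <= x)%N -> (y <= y')%N ->
  ideal_chips R M n x y' i <= ideal_chips R M n x y i.
Proof.
move=> M0 ix yy; have e0 : 0 <= (M%:R^-1 : R) <= 1 by rewrite invr_ge0 ler0n invf_le1 ?ltr0n ?ler1n.
rewrite /ideal_chips ler_wpM2l // ler_wpM2l ?mulr_ge0 ?exprn_ge0 ?ler0n //; first by case/andP: e0.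
by rewrite ler_wiXn2l //; [lra | lra | lia].
Qed.

Lemma expRN_quarter_ge l : (3 / 4) ^+ l * 4^-1 <= expR (- (1 + l%:R / 4)) :> R.
Proof.
rewrite opprD expRD mulrC ler_pM ?exprn_ge0 ?invr_ge0 //; first by lra.
  by have := expRN_ge 1; rewrite muln1 expr2; lra.
have -> : - (l%:R / 4) = l%:R * (- 4^-1) :> R by ring.
rewrite expRM_natl lerXn2r ?nnegrE ?expR_ge0 //; first by lra.
by have := @expR_ge1Dx R (- 4^-1); lra.
Qed.

Lemma three_halves_gt l : (1000 <= l)%N ->
  (2 * (513 * (60 * l)))%:R * (4 * (60 * l)%:R) < (3 / 2) ^+ l :> R.
Proof.
move=> l1; apply: (@lt_le_trans _ _ (2 ^+ (l %/ 2))); last first.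
  apply: (@le_trans _ _ ((3 / 2) ^+ (2 * (l %/ 2)))).
    by rewrite exprM lerXn2r ?nnegrE ?exprn_ge0 //; [lra | rewrite expr2; lra].
  by rewrite ler_weXn2l //; [lra | lia].
rewrite -natrX -!natrM ltr_nat.
have := leq_expn_div l1; move: (leq_exp2l (24 + 2 * (l %/ 10)) (l %/ 2) (isT : 1 < 2)%N).
rewrite (_ : (24 + _ <= _)%N); last by lia.
rewrite expnD expnM; set X := (2 ^ (l %/ 2))%N; rewrite expnAC.
by set Y := (2 ^ (l %/ 10))%N => h5 h6; rewrite -/Y in h5 *; nia.
Qed.

(** A side with [S] advances has at most [S] losses, so the diagonal is the worst case. The surplus
    [2^l] of chips over [2^(60 l)] pays for the factor [(3 / 4)^l / (4 d)] lost there, and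
    [(3 / 2)^l / (4 d)] exceeds the rounding error [2 * S]. *)
Lemma forces_final l : (1000 <= l)%N ->
  lister_forces (60 * l) (at_origin (2 ^ (61 * l))) (at_origin (2 ^ (61 * l))).
Proof.
(* As [513 = 1 + 1024 / 2], level [d] is exactly at its peak and [binomial_ge] applies with offset
   0. *)
move=> l1; set d := (60 * l)%N; set S := (513 * d)%N; set n := (2 ^ (61 * l))%N.
have ll := ltn_expl l (isT : (1 < 2)%N).
have main w : maxn (advances w) (losses w) = S -> advances w = S ->
    (0 < chips 1024 d.+1 n w d)%N.
  move=> mS aS; have sz := size_advances w.
  have szS : (size w <= 2 * S)%N by lia.
  have := @chips_ge R 1024 d.+1 n w d isT (ltnSn d).
  have := @ideal_chips_mono 1024 n (advances w) (losses w) S d isT ltac:(lia) ltac:(lia).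
  rewrite aS => h1 h2; have {h1 h2} := le_trans h1 h2.
  have d0 : (0 < d)%N by lia.
  have := @binomial_ge R d S 1024 0 d%:R _ isT (lexx _) _ _ _.
  rewrite /ideal_chips addnn -mul2n; set K := 'C(S, d)%:R * _ * _.
  set E := (X in expR X); move=> h hc.
  have {}h : 2^-1 ^+ d * expR E / d%:R <= K.
    apply: h; rewrite ?ltr0n //; first by lia.
      by rewrite addr0 /S natrM; ring.
    by rewrite -natrX ler_nat leq_pmulr.
  have hE : - E <= 1 + l%:R / 4.
    rewrite /E opprK expr0n mul0r add0r /S /d !natrM.
    by have : 0 <= l%:R :> R by []; lra.
  have h3 : (3 / 4) ^+ l * 4^-1 <= expR E.
    by apply: le_trans (expRN_quarter_ge l) _; rewrite ler_expR lerNl.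
  rewrite -(@ltr0n R).
  have : (size w)%:R <= (2 * S)%:R :> R by rewrite ler_nat.
  suff : (2 * S)%:R < n%:R * K by lra.
  have dR : 0 < d%:R :> R by rewrite ltr0n.
  have h4 : (3 / 2) ^+ l / (4 * d%:R) <= n%:R * K.
    apply: le_trans (ler_wpM2l (ler0n _ _) h).
    have -> : (3 / 2) ^+ l / (4 * d%:R) = 2 ^+ l * ((3 / 4) ^+ l * 4^-1) / d%:R :> R.
      rewrite (_ : 3 / 2 = 2 * (3 / 4)); last by field.
      by rewrite exprMn; field; rewrite gt_eqF.
    have -> : n%:R * (2^-1 ^+ d * expR E / d%:R) = 2 ^+ l * expR E / d%:R.
      rewrite /n natrX (_ : (61 * l)%N = (l + d)%N) 1?[_ ^+ (l + d)]exprD; last by rewrite /d; lia.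
      have P : 2 ^+ d * 2^-1 ^+ d = 1 :> R by rewrite -exprMn mulfV ?expr1n ?pnatr_eq0.
      rewrite -[LHS]mulrA -[RHS]mulrA; congr (_ * _).
      by rewrite !mulrA P mul1r.
    by rewrite ler_pM2r ?invr_gt0 // ler_pM2l ?exprn_gt0.
  by apply: lt_le_trans h4; rewrite ltr_pdivlMr ?mulr_gt0 // three_halves_gt.
apply: (@forces_uniform _ 1024 d.+1 n S) => w mS.
have [aS|aS] := eqVneq (advances w) S.
  by apply: (@forces_left _ _ _ d) => //; apply: main.
apply: (@forces_right _ _ _ d) => //; apply: main; rewrite advances_negb ?losses_negb.
  by rewrite maxnC.
by move: mS; lia.
Qed.

End Numerics.

(** * Lister's strategy *)

Section Opening.
Variables (R : realType) (l k i : nat).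
Hypothesis l1 : (1000 <= l)%N.
Hypothesis kl : (2 ^ (20 * l - 1) <= k)%N.
Hypothesis ku : (k <= 2 ^ (20 * l + 20))%N.
Hypothesis ki : k = (i + 60 * l).+1.

(* On a diagonal path level i is fullest at abscissa i M / 2, where it holds
   about n / 2^i chips.  The window [s0, S] starts there, and the opening stops
   when a coordinate of the path reaches S. *)
Let M := (2 ^ (20 * l + 20))%N.
Let H := (2 ^ (30 * l + 18))%N.
Let s0 := (i + i * 2 ^ (20 * l + 19))%N.
Let S := (s0 + H)%N.
Let n := (2 ^ (k + 8 * l))%N.
Let e : R := M%:R^-1.

Lemma M_gt1 : (1 < M)%N.
Proof. by rewrite -[1%N](expn0 2) ltn_exp2l //; lia. Qed.

Lemma i_ge : (2 ^ (20 * l - 2) <= i)%N.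
Proof.
have := @mul60_le l 1 (expn_gt0 2 l); have : (2 ^ (l + 7) <= 2 ^ (20 * l - 2))%N.
  by rewrite leq_exp2l //; lia.
have : (2 ^ (20 * l - 1) = 2 * 2 ^ (20 * l - 2))%N by rewrite -expnS; congr (2 ^ _)%N; lia.
by move: kl; rewrite ki; lia.
Qed.

Lemma i_le : (i <= M)%N.
Proof. by rewrite (leq_trans _ ku) // ki; lia. Qed.

Lemma i_gt0 : (0 < i)%N.
Proof. by rewrite (leq_trans _ i_ge) // expn_gt0. Qed.

Lemma M_half : (2 * 2 ^ (20 * l + 19) = M)%N.
Proof. by rewrite -expnS; congr (2 ^ _)%N; lia. Qed.

Lemma S_le : (S <= 2 ^ (40 * l + 40))%N.
Proof.
rewrite /S /s0 addnAC; apply: (@leqD_expl (40 * l + 39)); last by lia.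
  apply: (@leqD_expl (40 * l + 38)); last by lia.
    by apply: leq_expl i_le _; lia.
  by rewrite leq_exp2l //; lia.
by apply: leqM_expl i_le (leqnn _) _; lia.
Qed.

(** [D] bounds the offset of [x] from the peak of level [j]. In the exponent, [10 * l + 10] accounts
    for the root of [j] in Stirling's bound and [2 * (m + 7)] for the exponential factor. *)
Lemma kernel_ge j x D m : (0 < j)%N -> (j <= M)%N -> (x <= M ^ 2)%N ->
  (j * M + 2 * j <= 2 * x)%N -> (2 * x <= j * M + 2 * j + D * M)%N ->
  (D ^ 2 <= m * j)%N ->
  2^-1 ^+ (j + 10 * l + 2 * m + 24) <= 'C(x, j)%:R * e ^+ j * (1 - e) ^+ (2 * x - j).
Proof.
move=> j0 jM xM jx xD Dm.
have M0 : 0 < M%:R :> R by rewrite ltr0n (ltnW M_gt1).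
have j0' : 0 < j%:R :> R by rewrite ltr0n.
pose dl : R := 2 * (x%:R - j%:R) / M%:R - j%:R.
have jxR : j%:R * M%:R + 2 * j%:R <= 2 * x%:R :> R by rewrite -!natrM -natrD ler_nat.
have xDR : 2 * x%:R <= j%:R * M%:R + 2 * j%:R + D%:R * M%:R :> R.
  by rewrite -!natrM -!natrD ler_nat.
have dl0 : 0 <= dl by rewrite /dl subr_ge0 ler_pdivlMr //; lra.
have dlD : dl <= D%:R by rewrite /dl lerBlDr ler_pdivrMr // mulrDl; lra.
have r0 : 0 < 2 ^+ (10 * l + 10) :> R by rewrite exprn_gt0.
apply: le_trans (@binomial_ge R j x M dl _ _ M_gt1 dl0 _ r0 _); first last.
- rewrite -exprM -natrX ler_nat; apply: leq_trans jM _.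
  by rewrite leq_exp2l //; lia.
- by rewrite /dl; field; rewrite gt_eqF.
- by rewrite j0 /=; have : (j <= j * M)%N by [rewrite leq_pmulr // (ltnW M_gt1)]; lia.
have -> : (j + 10 * l + 2 * m + 24 = j + (2 * (m + 7) + (10 * l + 10)))%N by lia.
rewrite exprD -mulrA ler_wpM2l ?exprn_ge0 ?invr_ge0 //.
rewrite [2^-1 ^+ (_ + (10 * l + 10))]exprD ler_pM ?exprn_ge0 ?invr_ge0 //; last by rewrite exprVn.
apply: le_trans (expRN_ge R (m + 7)) _; rewrite ler_expR lerN2 natrD.
have h1 : dl ^+ 2 / j%:R <= m%:R.
  rewrite ler_pdivrMr // -natrM; apply: (@le_trans _ _ (D%:R ^+ 2)).
    by rewrite lerXn2r ?nnegrE ?ler0n.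
  by rewrite -natrX ler_nat.
have h2 : 2 * j%:R / M%:R <= 2 :> R by rewrite ler_pdivrMr // ler_pM2l // ler_nat.
have h3 : 4 * x%:R / M%:R ^+ 2 <= 4 :> R.
  by rewrite ler_pdivrMr ?exprn_gt0 // ler_pM2l // -natrX ler_nat.
by lra.
Qed.

(** Since [2 * H = 2^(10 l - 1) * M], the offset is at most [sqrt i] throughout the window, so the
    Gaussian loss is a constant factor. *)
Lemma window_ge x : (s0 <= x <= S)%N ->
  2^-1 ^+ (i + 10 * l + 26) <= 'C(x, i)%:R * e ^+ i * (1 - e) ^+ (2 * x - i).
Proof.
move=> /andP[sx xS].
rewrite (_ : (i + 10 * l + 26 = i + 10 * l + 2 * 1 + 24)%N); last by lia.
have Mh := M_half.
apply: (@kernel_ge i x (2 ^ (10 * l - 1)) 1 i_gt0 i_le).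
- apply: leq_trans xS (leq_trans S_le _).
  by rewrite -expnM leq_exp2l //; lia.
- by rewrite -Mh mulnCA -mulnDr leq_mul2l addnC.
- have <- : (2 * H = 2 ^ (10 * l - 1) * M)%N by rewrite -expnS -expnD; congr (2 ^ _)%N; lia.
  by rewrite -Mh mulnCA -!mulnDr leq_mul2l (addnC _ i).
- rewrite mul1n -expnM; apply: leq_trans i_ge.
  by rewrite leq_exp2l //; lia.
Qed.

Lemma e_itv : 0 < e < 1.
Proof. by rewrite invr_gt0 invf_lt1 ?ltr0n ?ltr1n ?M_gt1 ?(ltnW M_gt1). Qed.

Lemma window_scaled x : (s0 <= x <= S)%N ->
  2 ^+ (58 * l - 25) <= n%:R * ('C(x, i)%:R * e ^+ i * (1 - e) ^+ (2 * x - i)).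
Proof.
move=> /window_ge h; apply: le_trans (ler_wpM2l (ler0n _ _) h).
rewrite /n natrX mulrC half_pow_mul; last by lia.
by rewrite (_ : (k + 8 * l - (i + 10 * l + 26) = 58 * l - 25)%N) //; lia.
Qed.

Lemma s0_ge : (i <= s0)%N.
Proof. exact: leq_addr. Qed.

Lemma ideal_abreast Lam x y : abreast s0 S Lam x y ->
  2 ^+ (58 * l - 25) * (1 - e) ^+ Lam <= ideal_chips R M n x y i.
Proof.
case/and3P=> sx xS yx; have /andP[e0 e1] := e_itv; have si := s0_ge.
have h := @window_scaled x ltac:(lia).
have D0 : 0 <= 1 - e by lra.
apply: le_trans (ler_wpM2r (exprn_ge0 Lam D0) h) _.
rewrite /ideal_chips -/e -[leLHS]mulrA ler_wpM2l // -[leLHS]mulrA -exprD.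
rewrite ler_wpM2l ?mulr_ge0 ?exprn_ge0 ?ler0n ?(ltW e0) //.
by rewrite ler_wiXn2l //; [lra | lia].
Qed.

Lemma ideal_ahead Lam x y : ahead s0 S Lam x y ->
  2 ^+ (58 * l - 25) <= ideal_chips R M n x y i * (1 - e) ^+ Lam.
Proof.
case/and3P=> sx xS yx; have /andP[e0 e1] := e_itv; have si := s0_ge.
have h := @window_scaled x ltac:(lia).
have D0 : 0 <= 1 - e by lra.
apply: le_trans h _.
rewrite /ideal_chips -/e -[leRHS]mulrA ler_wpM2l // -[leRHS]mulrA -exprD.
rewrite ler_wpM2l ?mulr_ge0 ?exprn_ge0 ?ler0n ?(ltW e0) //.
by rewrite ler_wiXn2l //; [lra | lia].
Qed.

Lemma round_value w b c : (size w <= 2 * S)%N -> (40 * l + 42 <= b)%N -> (c + 20 * l + 20 = b)%N ->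
  2 ^+ b.+1 <= ideal_chips R M n (advances w) (losses w) i ->
  (2 ^ c <= chips M i.+1 n w i %/ M)%N.
Proof.
move=> sw lb cb h; have M0 : (0 < M)%N := ltnW M_gt1.
rewrite leq_divRL //; have -> : (2 ^ c * M = 2 ^ b)%N by rewrite -expnD; congr (2 ^ _)%N; lia.
have := le_trans h (@chips_ge R M i.+1 n w i M0 (ltnSn i)).
have sb : (size w <= 2 ^ b)%N.
  apply: leq_trans sw _; apply: leq_trans (_ : 2 * 2 ^ (40 * l + 40) <= _)%N.
    by rewrite leq_mul2l S_le.
  by rewrite -expnS leq_exp2l //; lia.
by rewrite -natrX -natrD ler_nat expnS => h2; lia.
Qed.

Lemma abreast_value Lam a w : (size w <= 2 * S)%N -> (a <= 10 * l)%N ->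
  2^-1 ^+ a <= (1 - e) ^+ Lam -> abreast s0 S Lam (advances w) (losses w) ->
  (2 ^ (38 * l - 46 - a) <= chips M i.+1 n w i %/ M)%N.
Proof.
move=> sw al ea /ideal_abreast h.
apply: (@round_value w (58 * l - 26 - a)) => //; try lia.
have E : (58 * l - 26 - a).+1 = (58 * l - 25 - a)%N by lia.
rewrite E -(half_pow_mul R (_ : a <= 58 * l - 25)%N); last by lia.
by apply: le_trans h; rewrite mulrC ler_wpM2l // exprn_ge0.
Qed.

Lemma ahead_value Lam a w : (size w <= 2 * S)%N ->
  (1 - e) ^+ Lam <= 2^-1 ^+ a -> ahead s0 S Lam (advances w) (losses w) ->
  (2 ^ (38 * l - 46 + a) <= chips M i.+1 n w i %/ M)%N.
Proof.
move=> sw ea /ideal_ahead h.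
have I0 : 0 <= ideal_chips R M n (advances w) (losses w) i.
  have /andP[e0 e1] := e_itv.
  by rewrite /ideal_chips !mulr_ge0 ?exprn_ge0 ?ler0n ?(ltW e0) // subr_ge0 ltW.
apply: (@round_value w (58 * l - 26 + a)) => //; try lia.
have {h}h := le_trans h (ler_wpM2l I0 ea).
rewrite (_ : (58 * l - 26 + a).+1 = (58 * l - 25 + a)%N) ?exprD; last by lia.
apply: (@le_trans _ _ (ideal_chips R M n (advances w) (losses w) i * 2^-1 ^+ a * 2 ^+ a)).
  by rewrite ler_pM2r ?exprn_gt0.
by rewrite -mulrA -exprMn mulVf ?pnatr_eq0 // expr1n mulr1.
Qed.

(** [(1 + e)^M >= 2] and [(1 - e^2)^M <= 1] give [(1 - e)^M <= 1 / 2]. *)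
Lemma pow_one_sub_le m a : (2 ^ a <= m)%N -> (1 - e) ^+ (M * m) <= 2^-1 ^+ (2 ^ a).
Proof.
have /andP[e0 e1] := e_itv; have D0 : 0 <= 1 - e by lra.
move=> am; rewrite exprM; apply: (@le_trans _ _ (2^-1 ^+ m)); last first.
  by rewrite ler_wiXn2l //; lra.
rewrite lerXn2r ?nnegrE ?exprn_ge0 ?invr_ge0 //.
have h : 2 <= (1 + e) ^+ M.
  apply: le_trans (@bernoulli R e M (ltW e0)).
  by rewrite mulfV ?gt_eqF ?ltr0n ?(ltnW M_gt1).
have p0 : 0 < (1 + e) ^+ M by rewrite exprn_gt0 //; lra.
rewrite -(ler_pM2r p0) -exprMn.
have : ((1 - e) * (1 + e)) ^+ M <= 1.
  apply: exprn_ile1; first by apply: mulr_ge0; lra.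
  by have : 0 <= e * e by [rewrite mulr_ge0 ?(ltW e0)]; lra.
by lra.
Qed.

(** The least [Lam] satisfying the upper bound works: as [1 - e >= 1 / 2], its power cannot fall
    below half of that bound. *)
Lemma threshold_ex : exists2 Lam, (4 * Lam <= H)%N &
  2^-1 ^+ (6 * l + 41) <= (1 - e) ^+ Lam <= 2^-1 ^+ (6 * l + 40).
Proof.
have /andP[e0 e1] := e_itv; have D0 : 0 <= 1 - e by lra.
have ex : exists m, (1 - e) ^+ m <= 2^-1 ^+ (6 * l + 40).
  exists (M * 2 ^ (10 * l - 4))%N; apply: le_trans (pow_one_sub_le (leqnn _)) _.
  rewrite ler_wiXn2l //; try lra.
  apply: leq_trans (ltnW (ltn_expl (10 * l - 4) _)); lia.
have HM : (M * 2 ^ (10 * l - 4) * 4 = H)%N.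
  by rewrite (_ : 4 = 2 ^ 2)%N // -!expnD; congr (2 ^ _)%N; lia.
case: (ex_minnP ex) => Lam h min; exists Lam.
  rewrite -HM mulnC leq_mul2r min // ; apply: le_trans (pow_one_sub_le (leqnn _)) _.
  rewrite ler_wiXn2l //; try lra.
  apply: leq_trans (ltnW (ltn_expl (10 * l - 4) _)); lia.
rewrite h andbT; case: Lam h min => [|Lam] h min.
  by rewrite expr0 exprn_ile1 ?invr_ge0 //; lra.
have h2 : 2^-1 ^+ (6 * l + 40) < (1 - e) ^+ Lam.
  by rewrite ltNge; apply/negP => /min; rewrite ltnn.
rewrite exprS (_ : (6 * l + 41 = (6 * l + 40).+1)%N) ?[2^-1 ^+ _.+1]exprS; last by lia.
have e2 : 2^-1 <= 1 - e.
  have : e <= 2^-1 by rewrite lef_pV2 ?posrE ?ltr0n ?(ltnW M_gt1) // ler_nat M_gt1.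
  by lra.
by rewrite ler_pM ?(ltW h2) ?exprn_ge0 ?invr_ge0.
Qed.

(** An advance made when ahead by [Lam] freezes at least [2^(44 l - 6)] chips, so with fewer than
    [2^(74 l)] frozen chips a side has at most [H / 4] such advances. Then [many_abreast] yields
    [H / 4 = 2^(30 l + 16)] advances freezing at least [2^(32 l - 87)] chips each. *)
Lemma many_frozen w : maxn (advances w) (losses w) = S ->
  (chips M i.+1 n w i.+1 < 2 ^ (74 * l))%N ->
  (chips M i.+1 n (map negb w) i.+1 < 2 ^ (74 * l))%N ->
  (2 ^ (61 * l) <= chips M i.+1 n w i.+1)%N.
Proof.
move=> mS F1 F2; have [Lam LH /andP[La Lb]] := threshold_ex.
have sz := size_advances w.
have sw : (size w <= 2 * S)%N by lia.
have few w' : (size w' <= 2 * S)%N -> (chips M i.+1 n w' i.+1 < 2 ^ (74 * l))%N ->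
    (4 * advances_at (ahead s0 S Lam) w' <= H)%N.
  move=> sw' F; have := @chips_top M i.+1 n (2 ^ (38 * l - 46 + (6 * l + 40))) (2 * S)
    (ahead s0 S Lam) w' isT (fun w' h => @ahead_value Lam (6 * l + 40) w' h Lb) sw'.
  move=> h; have {h F} := leq_ltn_trans h F.
  rewrite (_ : 74 * l = 30 * l + 6 + (38 * l - 46 + (6 * l + 40)))%N; last by lia.
  rewrite [(2 ^ (30 * l + 6 + _))%N]expnD ltn_pmul2r ?expn_gt0 // => h.
  have : (4 * 2 ^ (30 * l + 6) <= H)%N.
    by rewrite (_ : 4 = 2 ^ 2)%N // -expnD leq_exp2l //; lia.
  by lia.
have H0 : (0 < H)%N by rewrite expn_gt0.
have := many_abreast LH H0 mS (few _ sw F1) (few _ _ F2).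
rewrite size_map => /(_ sw) h.
have := @chips_top M i.+1 n (2 ^ (38 * l - 46 - (6 * l + 41))) (2 * S)
    (abreast s0 S Lam) w isT (fun w' h => @abreast_value Lam (6 * l + 41) w' h ltac:(lia) La) sw.
apply: leq_trans.
apply: (@leq_trans (2 ^ (30 * l + 16) * 2 ^ (38 * l - 46 - (6 * l + 41)))).
  by rewrite -expnD leq_exp2l //; lia.
have HE : (H = 4 * 2 ^ (30 * l + 16))%N.
  by rewrite (_ : 4 = 2 ^ 2)%N // -expnD; congr (2 ^ _)%N; lia.
by rewrite leq_mul2r; apply/orP; right; move: h; rewrite [leqLHS]HE leq_mul2l.
Qed.

(** The side described by [w] has not entered the window, so the other one is ahead by [H / 2] in
    the second half of it, where this lead multiplies its chips by at least [2^(2^(10 l - 3))]. *)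
Lemma far_frozen w : losses w = S -> (advances w < s0)%N ->
  (2 ^ (2 ^ (10 * l - 3)) <= chips M i.+1 n (map negb w) i.+1)%N.
Proof.
move=> lS aS; have := far_ahead lS (ltnW aS); rewrite -/S => h.
have sz := size_advances w.
have HM : (H %/ 2 = M * 2 ^ (10 * l - 3))%N.
  rewrite /H (_ : 30 * l + 18 = (30 * l + 17).+1)%N; last by lia.
  by rewrite expnS mulKn // -expnD; congr (2 ^ _)%N; lia.
have eL : (1 - e) ^+ (H %/ 2) <= 2^-1 ^+ (2 ^ (10 * l - 3)).
  by rewrite HM; apply: pow_one_sub_le.
have := @chips_top M i.+1 n (2 ^ (38 * l - 46 + 2 ^ (10 * l - 3))) (2 * S)
    (ahead s0 S (H %/ 2)) (map negb w) isT (fun w' h => @ahead_value _ _ w' h eL).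
rewrite size_map => /(_ ltac:(lia)); apply: leq_trans.
apply: leq_trans (_ : 2 ^ (38 * l - 46 + 2 ^ (10 * l - 3)) <= _)%N.
  by rewrite leq_exp2l // leq_addl.
rewrite leq_pmull //; have : (0 < H)%N by rewrite expn_gt0.
by lia.
Qed.

(* Level j is low enough for its chips to be worth lifting, using up the frozen
   chips of the other side, and high enough to still be well populated. *)
Let j := (i - 2 ^ (11 * l))%N.

Lemma j_ge : (2 ^ (20 * l - 3) <= j)%N.
Proof.
have := i_ge; rewrite /j.
have -> : (2 ^ (20 * l - 2) = 2 ^ (20 * l - 3) + 2 ^ (20 * l - 3))%N.
  by rewrite addnn -mul2n -expnS; congr (2 ^ _)%N; lia.
have : (2 ^ (11 * l) <= 2 ^ (20 * l - 3))%N by rewrite leq_exp2l //; lia.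
by lia.
Qed.

Lemma j_add : (j + 2 ^ (11 * l) = i)%N.
Proof.
have h := i_ge; rewrite /j subnK //; apply: leq_trans h.
by rewrite leq_exp2l //; lia.
Qed.

(** The offset from the peak of level [j] is at most [2^(11 l + 1)], which costs a factor
    [2^(2 * 2^(2 l + 5))]; up to [H] losses beyond the diagonal cost at most [2^(2^(10 l))].
    Together with the smaller terms this fits into [2^(2^(10 l + 2))]. *)
Lemma reservoir_ge w : (s0 <= advances w <= S)%N -> (losses w <= S)%N ->
  (2 ^ (k - j - 2 ^ (10 * l + 2)) <= chips M i.+1 n w j)%N.
Proof.
move=> /andP[sx xS] yS; set x := advances w in sx xS *.
have M1 : (1 < M)%N := M_gt1.
have jg := j_ge; have jE := j_add; have SL : (S <= 2 ^ (40 * l + 40))%N := S_le.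
have Mh : (2 * 2 ^ (20 * l + 19) = M)%N := M_half.
have j0 : (0 < j)%N by apply: leq_trans jg; rewrite expn_gt0.
set g := (2 ^ (11 * l))%N in jE *.
have HM : (2 * H = 2 ^ (10 * l - 1) * M)%N.
  by rewrite -expnS -expnD; congr (2 ^ _)%N; clear -l1; lia.
have g2 : (2 ^ (10 * l - 1) + 1 <= g)%N.
  apply: (@leqD_expl (11 * l - 1)); rewrite ?expn_gt0 //; last by clear -l1; lia.
  by rewrite leq_exp2l //; clear -l1; lia.
have sE : (2 * s0 = i * M + 2 * i)%N by rewrite /s0 mulnDr mulnCA Mh addnC.
have K := @kernel_ge j x (2 * g) (2 ^ (2 * l + 5)) j0 _ _ _ _ _.
have {}K : 2^-1 ^+ (j + 10 * l + 2 * 2 ^ (2 * l + 5) + 24) <=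
    'C(x, j)%:R * e ^+ j * (1 - e) ^+ (2 * x - j).
  apply: K.
  - by apply: leq_trans i_le; rewrite -jE leq_addr.
  - by apply: leq_trans xS (leq_trans SL _); rewrite -expnM leq_exp2l //; clear -l1; lia.
  - apply: (@leq_trans (2 * s0)); last by rewrite leq_mul2l sx orbT.
    by rewrite sE -jE; apply: leq_add; rewrite ?leq_mul2r ?leq_mul2l leq_addr orbT.
  - apply: (@leq_trans (2 * S)); first by rewrite leq_mul2l xS orbT.
    rewrite /S mulnDr sE HM -jE.
    have gM : ((2 ^ (10 * l - 1) + 1) * M <= g * M)%N by rewrite leq_mul2r g2 orbT.
    have gg : (2 * g <= M)%N by rewrite -expnS leq_exp2l //; clear -l1; lia.
    by rewrite !mulnDl in gM *; move: gM gg; clear; lia.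
  - apply: (@leq_trans (2 ^ (2 * l + 5) * 2 ^ (20 * l - 3))).
      by rewrite -expnS -expnM -expnD leq_exp2l //; clear -l1; lia.
    by rewrite leq_mul2l jg orbT.
have /andP[e0 e1] : 0 < e < 1 := e_itv.
have D0 : 0 <= 1 - e by lra.
have D1 : 1 - e <= 1 by lra.
have lw : (x + losses w - j <= 2 * x - j + H)%N.
  by move: sx yS; rewrite /S; clear; lia.
have EH : 2^-1 ^+ (2 ^ (10 * l)) <= (1 - e) ^+ H.
  apply: le_trans (one_sub_inv_ge R H M1).
  rewrite (_ : (2 ^ (10 * l) = 2 * 2 ^ (10 * l - 1))%N); last first.
    by rewrite -expnS; congr (2 ^ _)%N; clear -l1; lia.
  apply: le_trans (expRN_ge R _) _; rewrite ler_expR lerN2.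
  have M0 : 0 < M%:R :> R by rewrite ltr0n (ltnW M1).
  have HR : H%:R = 2^-1 * (2 ^ (10 * l - 1))%:R * M%:R :> R.
    by rewrite -mulrA -natrM -HM natrM mulKf // pnatr_eq0.
  have -> : H%:R / M%:R = 2^-1 * (2 ^ (10 * l - 1))%:R :> R by rewrite HR mulfK // gt_eqF.
  have -> : 2 * H%:R / M%:R ^+ 2 = (2 ^ (10 * l - 1))%:R / M%:R :> R.
    by rewrite HR; field; rewrite gt_eqF.
  have : (2 ^ (10 * l - 1))%:R / M%:R <= (2 ^ (10 * l - 1))%:R * 2^-1 :> R.
    by rewrite ler_wpM2l // lef_pV2 ?posrE // ler_nat.
  by lra.
have hc := @chips_ge R M i.+1 n w j (ltnW M1) (leq_trans (leq_addr _ _) (eq_leq (congr1 succn jE))).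
set u := (j + 10 * l + 2 * 2 ^ (2 * l + 5) + 24)%N in K.
have h : n%:R * (2^-1 ^+ u * 2^-1 ^+ (2 ^ (10 * l))) <=
    (chips M i.+1 n w j)%:R + (size w)%:R :> R.
  apply: le_trans hc; rewrite /ideal_chips -/e ler_wpM2l //.
  apply: le_trans (ler_pM _ _ K EH) _; rewrite ?exprn_ge0 ?invr_ge0 //.
  rewrite -[leLHS]mulrA -exprD ler_wpM2l ?mulr_ge0 ?exprn_ge0 ?ler0n ?(ltW e0) //.
  by rewrite ler_wiXn2l.
have p1 : (60 * l + 100 <= 2 ^ (10 * l))%N.
  apply: leq_trans (@mul60_le l 100 _) _; last by rewrite leq_exp2l //; clear -l1; lia.
  by apply: (@leq_trans (2 ^ 10)) => //; rewrite leq_exp2l //; clear -l1; lia.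
have p2 : (2 * 2 ^ (2 * l + 5) <= 2 ^ (10 * l))%N by rewrite -expnS leq_exp2l //; clear -l1; lia.
have p3 : (2 ^ (10 * l + 2) = 4 * 2 ^ (10 * l))%N by rewrite expnD mulnC.
have p4 : (2 ^ 3 * 2 ^ (10 * l) <= g)%N by rewrite -expnD leq_exp2l //; clear -l1; lia.
rewrite (_ : 2 ^ 3 = 8)%N // in p4.
rewrite p3; set T := (k - j - 4 * 2 ^ (10 * l))%N.
have T1 : (T.+1 <= k + 8 * l - (u + 2 ^ (10 * l)))%N.
  by rewrite /T /u; move: ki jE; clear -p1 p2 p3 p4 l1; lia.
have T2 : (40 * l + 41 <= T)%N by rewrite /T; move: ki jE; clear -p1 p2 p3 p4 l1; lia.
have sz : (size w <= 2 ^ T)%N.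
  apply: (@leq_trans (2 ^ (40 * l + 41))); last by rewrite leq_exp2l.
  rewrite -size_advances addnS expnS mul2n -addnn.
  by apply: leq_add; apply: leq_trans SL.
have T3 : (u + 2 ^ (10 * l) <= k + 8 * l)%N by move: T1; clear; lia.
have E : n%:R * 2^-1 ^+ (u + 2 ^ (10 * l)) = 2 ^+ (k + 8 * l - (u + 2 ^ (10 * l))) :> R.
  by rewrite -(half_pow_mul R T3) /n natrX mulrC.
move: h; rewrite -[2^-1 ^+ u * _]exprD E.
move=> h; have := le_trans (_ : 2 ^+ T.+1 <= _) h.
rewrite ler_weXn2l ?ler1n // => /(_ isT).
rewrite -[2 ^+ T.+1]natrX -natrD ler_nat [(2 ^ T.+1)%N]expnS.
have key (a b c : nat) : (b <= a)%N -> (2 * a <= c + b)%N -> (a <= c)%N by clear; lia.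
exact: key sz.
Qed.

(** With [A / B = 65 / 32] and [fr = 128] a lift keeps a fraction [4191 / 8320] of the chips,
    slightly more than one half. Over the [G >= 2^(11 l)] lifts this small excess makes up for the
    deficit [2^T]. A level costs [2^(62 l + 15)] frozen chips, by [expn65_le], and there are at most
    [2^(11 l + 1)] levels; hence the threshold [2^(74 l)]. *)
Lemma reservoir_wins a b : (2 ^ (k - j - 2 ^ (10 * l + 2)) <= a j)%N ->
  (2 ^ (74 * l) <= b i.+1)%N -> lister_forces k a b.
Proof.
move=> aj bq; have jE := j_add.
set G := (k - j)%N in aj; set T := (2 ^ (10 * l + 2))%N in aj.
have GE : (G = 60 * l + 1 + 2 ^ (11 * l))%N by rewrite /G; move: ki jE; clear; lia.
have G1 : (G <= 2 ^ (11 * l + 1))%N.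
  rewrite GE; apply: (@leqD_expl (11 * l)); last by lia.
    apply: leq_trans (@mul60_le l 1 _) _; rewrite ?expn_gt0 // leq_exp2l //; move: l1; clear; lia.
  by [].
have l60 := expn65_le l.
have big : (8 + (362 * l + T) <= 2 ^ (11 * l - 8))%N.
  have -> : (11 * l - 8 = (l - 12) + (10 * l + 4))%N by move: l1; clear; lia.
  rewrite expnD /T; have h1 : (60 * l + 1 <= 2 ^ (10 * l + 2))%N.
    apply: leq_trans (@mul60_le l 1 _) _; rewrite ?expn_gt0 // leq_exp2l //; move: l1; clear; lia.
  have h2 : (2 ^ 2 * 2 ^ (10 * l + 2) = 2 ^ (10 * l + 4))%N.
    by rewrite -expnD; congr (2 ^ _)%N; move: l1; clear; lia.
  have h3 : (2 ^ 3 <= 2 ^ (l - 12))%N by rewrite leq_exp2l //; move: l1; clear; lia.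
  apply: leq_trans (leq_mul h3 (leqnn _)); rewrite -h2.
  rewrite (_ : 2 ^ 2 = 4)%N // (_ : 2 ^ 3 = 8)%N //.
  by move: h1; move: (2 ^ (10 * l + 2))%N => y; move: l1; clear; lia.
have TG : (T <= G)%N.
  rewrite GE; apply: leq_trans (leq_addl _ _); rewrite leq_exp2l //; move: l1; clear; lia.
apply: (@lift_geom k i.+1 (60 * l) 65 32 128 (2 ^ (62 * l + 15)) _ _ _ _ _ G j (2 ^ (G - T))) => //.
- by move: l1; clear; lia.
- have -> : (2 ^ (62 * l + 15) * 32 ^ (60 * l).-1 = 2 ^ (62 * l + 15 + 5 * (60 * l).-1))%N.
    by rewrite [RHS]expnD (expnM 2 5).
  apply: (@leqM_expl 9 (362 * l)) => //.
  by move: l1; clear; lia.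
- by rewrite /G; move: ki jE; clear; lia.
- have T0 : (0 < 2 ^ T)%N by rewrite expn_gt0.
  rewrite -(leq_pmul2r T0) [leqRHS]mulnAC -[(2 ^ (G - T) * 2 ^ T)%N]expnD subnK // -expnMn.
  have -> : (2 * ((65 - 32) * (128 - 1)) = 128 * 65 + 62)%N by clear; lia.
  apply: leq_trans (@leq_double_expn (128 * 65) 62 135 (2 ^ (11 * l - 8)) G _ _ _) => //.
  + rewrite mulnAC leq_mul2r; apply/orP; right.
    apply: (@leqM_expl (7 + 362 * l) T) => //; first exact: (@leqM_expl 7 (362 * l)).
    by move: big; clear; lia.
  + rewrite GE; apply: leq_trans (leq_addl _ _).
    have -> : (2 ^ (11 * l) = 2 ^ 8 * 2 ^ (11 * l - 8))%N.
      by rewrite -expnD; congr (2 ^ _)%N; move: l1; clear; lia.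
    by rewrite leq_mul2r; apply/orP; right.
- apply: leq_trans bq; apply: (@leqM_expl (11 * l + 1) (62 * l + 15)) => //.
  by move: l1; clear; lia.
Qed.

(** Frozen chips are so plentiful that [A / B = 16] is affordable, and a lift keeps the fraction
    [15 / 16] times [127 / 128]. About [(9 / 8)^k] chips survive up to [k] lifts, because [9 / 8]
    times this fraction exceeds 1. *)
Lemma far_wins j' z a b : (j' <= k)%N ->
  (18 ^ k <= 16 ^ k * 2 ^ (2 ^ (10 * l) + 12 * l + 20) * z)%N ->
  (z <= a j')%N -> (2 ^ (2 ^ (10 * l - 3)) <= b i.+1)%N -> lister_forces k a b.
Proof.
set U := (2 ^ (10 * l) + 12 * l + 20)%N => jk hz aj bq.
have p1 : (60 * l + 100 <= 2 ^ (l + 7))%N.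
  apply: (@mul60_le l 100); apply: (@leq_trans (2 ^ 10)) => //.
  by rewrite leq_exp2l //; move: l1; clear; lia.
have p2 : (5 * (60 * l + 100) <= 2 ^ (10 * l - 3))%N.
  by apply: (@leqM_expl 3 (l + 7)) => //; move: l1; clear; lia.
have p3 : (2 * 2 ^ (10 * l) <= 2 ^ (20 * l - 6))%N.
  by rewrite -expnS leq_exp2l //; move: l1; clear; lia.
have p4 : (2 ^ (10 * l) = 8 * 2 ^ (10 * l - 3))%N.
  by rewrite (_ : 8 = 2 ^ 3)%N // -expnD; congr (2 ^ _)%N; move: l1; clear; lia.
have tk : (22 * 2 ^ (20 * l - 6) <= k)%N.
  apply: leq_trans kl; have -> : (2 ^ (20 * l - 1) = 2 ^ 5 * 2 ^ (20 * l - 6))%N.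
    by rewrite -expnD; congr (2 ^ _)%N; move: l1; clear; lia.
  by rewrite leq_mul2r; apply/orP; right.
set c := (128 * 16 ^ (60 * l))%N.
set X := (128 * 16)%N; set Y := ((16 - 1) * (128 - 1))%N.
have Y0 : (0 < Y)%N by [].
have YX : (Y <= X)%N by rewrite /X /Y; clear; lia.
have c2 : (c * 2 ^ U <= 2 ^ (2 ^ (20 * l - 6)))%N.
  have -> : (c * 2 ^ U = 2 ^ (7 + 4 * (60 * l) + U))%N.
    by rewrite /c -[16%N]/(2 ^ 4)%N -expnM -[128%N]/(2 ^ 7)%N -!expnD.
  rewrite leq_exp2l // /U; move: p2 p3 p4; clear.
  by move: (2 ^ (10 * l))%N (2 ^ (10 * l - 3))%N (2 ^ (20 * l - 6))%N => x y v; lia.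
have full : (c * X ^ k <= z * Y ^ k)%N.
  have P0 : (0 < 16 ^ k * 2 ^ U)%N by rewrite muln_gt0 !expn_gt0.
  rewrite -(leq_pmul2r P0).
  have -> : (c * X ^ k * (16 ^ k * 2 ^ U) = c * 2 ^ U * (X * 16) ^ k)%N.
    by rewrite expnMn; clear; lia.
  have -> : (z * Y ^ k * (16 ^ k * 2 ^ U) = 16 ^ k * 2 ^ U * z * Y ^ k)%N by clear; lia.
  apply: leq_trans (leq_mul hz (leqnn _)); rewrite -expnMn.
  have -> : (18 * Y = X * 16 + 1522)%N by rewrite /X /Y; clear; lia.
  apply: leq_trans (@leq_double_expn (X * 16) 1522 22 (2 ^ (20 * l - 6)) k _ _ _) => //.
  by rewrite leq_mul2r c2 orbT.
set G := (k - j')%N.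
have Gk : (G <= k)%N by rewrite leq_subr.
apply: (@lift_geom k i.+1 (60 * l) 16 1 128 (2 ^ (240 * l + 9)) _ _ _ _ _ G j' z) => //.
- by move: l1; clear; lia.
- rewrite exp1n muln1 (_ : 4 * 128 = 2 ^ 9)%N // (_ : 16 = 2 ^ 4)%N // -expnM -expnD.
  by rewrite leq_exp2l //; clear; lia.
- by rewrite /G subnKC.
- rewrite -/c -/X -/Y.
  have P0 : (0 < Y ^ (k - G))%N by rewrite expn_gt0 Y0.
  rewrite -(leq_pmul2r P0) -[(z * _ * _)%N]mulnA -expnD subnKC //.
  apply: leq_trans full; rewrite -[in leqRHS](subnKC Gk) expnD mulnA.
  by rewrite leq_mul2l leq_expn2r // orbT.
- apply: leq_trans bq; apply: (@leqM_expl (20 * l + 20) (240 * l + 9)) => //.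
    exact: leq_trans Gk ku.
  by move: p2; clear; lia.
Qed.

(** [S / M] is about [i / 2 + 2^(10 l - 2)], and [expR (- 1 / 2) >= (3 / 4)^2]. *)
Lemma far_decay : 2^-1 ^+ (2 ^ (10 * l)) * (9 / 16) ^+ k <= (1 - e) ^+ S.
Proof.
have M1 : (1 < M)%N := M_gt1; have M0 : 0 < M%:R :> R by rewrite ltr0n (ltnW M1).
apply: le_trans (one_sub_inv_ge R S M1).
have q1 : (9 / 16) ^+ k <= expR (- (k%:R / 2)) :> R.
  have -> : - (k%:R / 2) = (2 * k)%:R * (- 4^-1) :> R by rewrite natrM; field.
  rewrite expRM_natl exprM lerXn2r ?nnegrE ?exprn_ge0 ?expR_ge0 //; first by lra.
  have := @expR_ge1Dx R (- 4^-1); have := @expR_ge0 R (- 4^-1); nra.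
have q2 : 2^-1 ^+ (2 ^ (10 * l)) <= expR (- (3 + 2 ^ (10 * l - 2))%:R) :> R.
  apply: le_trans (expRN_ge R _); rewrite ler_wiXn2l ?invr_ge0 //; first by lra.
  have -> : (2 ^ (10 * l) = 4 * 2 ^ (10 * l - 2))%N.
    by rewrite (_ : 4 = 2 ^ 2)%N // -expnD; congr (2 ^ _)%N; move: l1; clear; lia.
  have : (2 ^ 2 <= 2 ^ (10 * l - 2))%N by rewrite leq_exp2l //; move: l1; clear; lia.
  by rewrite (_ : 2 ^ 2 = 4)%N //; move: (2 ^ (10 * l - 2))%N => x; clear; lia.
apply: le_trans (ler_pM _ _ q2 q1) _; rewrite ?exprn_ge0 ?invr_ge0 //; first by lra.
rewrite -expRD ler_expR -opprD lerN2 natrD.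
have SE : S%:R = i%:R + i%:R * (M%:R / 2) + (2 ^ (10 * l - 2))%:R * M%:R :> R.
  have Mh : M%:R / 2 = (2 ^ (20 * l + 19))%:R :> R.
    by rewrite -M_half natrM mulrAC divff ?pnatr_eq0 // mul1r.
  have HE : (2 ^ (10 * l - 2) * M = H)%N.
    by rewrite -expnD; congr (2 ^ _)%N; move: l1; clear; lia.
  by rewrite Mh -!natrM HE -!natrD.
have h1 : i%:R / M%:R <= 1 :> R by rewrite ler_pdivrMr // mul1r ler_nat i_le.
have h2 : 2 * S%:R / M%:R ^+ 2 <= 2 :> R.
  rewrite ler_pdivrMr ?exprn_gt0 // ler_pM2l // -natrX ler_nat.
  by apply: leq_trans S_le _; rewrite -expnM leq_exp2l //; move: l1; clear; lia.
have -> : S%:R / M%:R = i%:R / M%:R + i%:R / 2 + (2 ^ (10 * l - 2))%:R :> R.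
  by rewrite SE; field; rewrite gt_eqF.
have h3 : i%:R <= k%:R :> R by rewrite ler_nat ki; clear; lia.
by lra.
Qed.

(** By [chips_total] and [far_decay] the side keeps roughly [2^k (9 / 16)^k = (9 / 8)^k] chips in
    total, and one of the [i + 2] levels holds at least the average. *)
Lemma far_reservoir w : losses w = S -> exists2 j', (j' <= k)%N &
  (18 ^ k <= 16 ^ k * 2 ^ (2 ^ (10 * l) + 12 * l + 20) * chips M i.+1 n w j')%N.
Proof.
move=> lS; apply: contrapT => nex.
set U := (2 ^ (10 * l) + 12 * l + 20)%N in nex.
have small (x : 'I_i.+2) : (16 ^ k * 2 ^ U * chips M i.+1 n w x < 18 ^ k)%N.
  rewrite ltnNge; apply/negP => h; apply: nex; exists (x : nat) => //.
  by rewrite -ltnS (leq_trans (ltn_ord x)) // ki; move: l1; clear; lia.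
set s := (\sum_(x < i.+2) chips M i.+1 n w x)%N.
have up : (16 ^ k * 2 ^ U * s < 2 ^ (20 * l + 20) * 18 ^ k)%N.
  apply: (@leq_trans (i.+2 * 18 ^ k)); last first.
    rewrite leq_mul2r; apply/orP; right; apply: leq_trans ku.
    by rewrite ki; move: l1; clear; lia.
  rewrite /s big_distrr /= -[i.+2 in leqRHS]card_ord -sum_nat_const.
  rewrite big_ord_recl [X in (_ < X)%N]big_ord_recl -addSn; apply: leq_add; first exact: small.
  by apply: leq_sum => x _; apply: ltnW; apply: small.
have tot := @chips_total M i.+1 n w; rewrite lS -/s in tot.
have M1 : (1 < M)%N := M_gt1; have M0 : 0 < M%:R :> R by rewrite ltr0n (ltnW M1).
have lo : n%:R * (1 - e) ^+ S <= s%:R :> R.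
  rewrite -(ler_pM2l (exprn_gt0 S M0)) mulrCA -exprMn mulrBr mulr1 mulfV ?gt_eqF //.
  by rewrite -(natrB _ (ltnW M1)) -!natrX -!natrM ler_nat.
have := le_trans (ler_wpM2l (ler0n _ n) far_decay) lo.
set V := (2 ^ (10 * l))%N in U nex small up *.
move=> h; suff : (2 ^ (8 * l) * 18 ^ k <= 2 ^ V * 16 ^ k * s)%N.
  move=> h2; have := leq_mul (leqnn (2 ^ (12 * l + 20))) h2.
  have -> : (2 ^ (12 * l + 20) * (2 ^ (8 * l) * 18 ^ k) = 2 ^ (20 * l + 20) * 18 ^ k)%N.
    by rewrite mulnA -expnD; congr (2 ^ _ * _)%N; clear; lia.
  have -> : (2 ^ (12 * l + 20) * (2 ^ V * 16 ^ k * s) = 16 ^ k * 2 ^ U * s)%N.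
    have -> : (2 ^ U = 2 ^ V * 2 ^ (12 * l + 20))%N by rewrite -expnD /U addnA.
    by clear; lia.
  by rewrite leqNgt up.
rewrite -(ler_nat R) !natrM !natrX.
have P : 2 ^+ V * 2^-1 ^+ V = 1 :> R by rewrite -exprMn mulfV ?expr1n ?pnatr_eq0.
have Q : 0 <= 2 ^+ V * 16 ^+ k :> R by rewrite mulr_ge0 ?exprn_ge0.
apply: le_trans (ler_wpM2l Q h).
have -> : 2 ^+ V * 16 ^+ k * (n%:R * (2^-1 ^+ V * (9 / 16) ^+ k)) =
   (2 ^+ V * 2^-1 ^+ V) * (n%:R * (16 * (9 / 16)) ^+ k) :> R.
  by rewrite [(16 * _) ^+ k]exprMn; ring.
rewrite P mul1r /n natrX [2 ^+ (k + _)]exprD.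
have -> : 16 * (9 / 16) = 9 :> R by field.
have -> : 18 = 2 * 9 :> R by ring.
by rewrite exprMn [X in _ <= X * _]mulrC -[leRHS]mulrA.
Qed.

Lemma forces_losses w : losses w = S -> (advances w <= S)%N ->
  lister_forces k (chips M i.+1 n w) (chips M i.+1 n (map negb w)).
Proof.
move=> lS aS; case: (ltnP (advances w) s0) => [/(far_frozen lS) F|sa].
  have [j' j'k z] := far_reservoir lS.
  exact: (far_wins j'k z (leqnn _) F).
have mS : maxn (advances w) (losses w) = S by rewrite lS; apply/maxn_idPr.
have lw : (losses w <= S)%N by rewrite lS.
case: (leqP (2 ^ (74 * l)) (chips M i.+1 n (map negb w) i.+1)) => Fr.
  by apply: reservoir_wins Fr; apply: reservoir_ge => //; rewrite sa.
case: (leqP (2 ^ (74 * l)) (chips M i.+1 n w i.+1)) => Fl.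
  apply: forces_sym; apply: reservoir_wins Fl.
  apply: reservoir_ge; rewrite ?advances_negb ?losses_negb // lS leqnn andbT.
  exact: leq_addr.
have kE : (k = i.+1 + 60 * l)%N by rewrite ki; clear; lia.
have F := forces_shift i.+1 (forces_final R l1); rewrite -kE in F.
have frozen v : (2 ^ (61 * l) <= chips M i.+1 n v i.+1)%N ->
    forall x, (shift_by i.+1 (at_origin (2 ^ (61 * l))) x <= chips M i.+1 n v x)%N.
  move=> hv x; rewrite /shift_by /at_origin; case: ltnP => // ix.
  case: eqP => // x0; have -> // : x = i.+1 by move: ix x0; clear; lia.
apply: (forces_mono _ _ F); apply: frozen; apply: many_frozen => //.
  by rewrite advances_negb losses_negb maxnC.
by rewrite (mapK negbK).
Qed.

Lemma forces_opening : lister_forces k (at_origin n) (at_origin n).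
Proof.
apply: (@forces_uniform k M i.+1 n S) => w mS.
have [lS|/eqP lS] := eqVneq (losses w) S; first by apply: forces_losses => //; lia.
apply: forces_sym; rewrite -{2}(mapK negbK w).
by apply: forces_losses; rewrite ?advances_negb ?losses_negb; lia.
Qed.

End Opening.

(** * The asymptotic statement *)

Lemma ln2_gt0 (R : realType) : 0 < ln 2 :> R.
Proof. by apply: ln_gt0; rewrite ltr1n. Qed.

Lemma log2_le (R : realType) (x : R) m : 0 < x -> x <= 2 ^+ m -> log2 x <= m%:R.
Proof.
move=> x0 xm; rewrite /log2 ler_pdivrMr ?ln2_gt0 // mulr_natl -lnXn //.
by rewrite ler_ln ?posrE ?exprn_gt0.
Qed.

(** [N] is at least [2^(k + 8 l)] for [k = u - 8 l], so [k] is too small for Painter. After lowering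
    [k] by [l / 2], the bound [2^(k + 9 l - 3)] is still above [2^(u + 1)], so lists of this size
    suffice. *)
Lemma paint_choice_gap (R : realType) N u l : (1000 <= l)%N ->
  (2 ^ (20 * l) <= u)%N -> (u < 2 ^ (20 * l + 20))%N -> (2 ^ u <= N)%N -> (N < 2 ^ u.+1)%N ->
  (choice_number (biclique N N) + l %/ 2 < paint_number (biclique N N))%N.
Proof.
move=> l1 ul uu Nu Nu1.
have small : (60 * l + 1 <= 2 ^ (20 * l - 1))%N.
  apply: (@leq_trans (2 ^ (l + 7))); last by rewrite leq_exp2l //; move: l1; clear; lia.
  by apply: mul60_le; rewrite expn_gt0.
have half : (2 ^ (20 * l) = 2 * 2 ^ (20 * l - 1))%N.
  by rewrite -expnS; congr (2 ^ _)%N; move: l1; clear; lia.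
have big : (2 ^ (20 * l - 1) + 60 * l + 1 <= u)%N by move: small half ul; clear; lia.
have ch : (choice_number (biclique N N) <= u - 8 * l - l %/ 2)%N.
  rewrite /choice_number; case: ex_minnP => c _; apply; apply/asboolP.
  apply: (@choosable_biclique l) => //.
  - by move: big; clear; lia.
  - by apply: leq_trans (ltnW uu); rewrite -subnDA leq_subr.
  - apply: leq_trans (ltnW Nu1) _; rewrite leq_exp2l //; move: big l1; clear; lia.
have pn : (u - 8 * l < paint_number (biclique N N))%N.
  apply: forces_paint_number.
    by apply: leq_trans Nu; rewrite -{1}(expn1 2) leq_exp2l //; move: big l1; clear; lia.
  have kl : (2 ^ (20 * l - 1) <= u - 8 * l)%N by move: big; clear; lia.
  have ku : (u - 8 * l <= 2 ^ (20 * l + 20))%N by apply: leq_trans (ltnW uu); apply: leq_subr.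
  have l2 := ltn_expl (20 * l - 1) (isT : (1 < 2)%N).
  have ki : (u - 8 * l = (u - 68 * l - 1 + 60 * l).+1)%N by move: big l2 l1; clear; lia.
  have uE : (u - 8 * l + 8 * l = u)%N by move: big l1; clear; lia.
  have F := forces_opening R l1 kl ku ki; rewrite uE in F.
  by apply: (forces_mono _ _ F) => -[|x].
by move: ch pn big l1; clear; lia.
Qed.

Theorem corollary2 (R : realType) :
  exists c : R, 0 < c /\
  exists N0 : nat, forall N : nat, (N0 <= N)%N ->
    c * log2 (log2 (N%:R : R)) <=
      (paint_number (biclique N N))%:R - (choice_number (biclique N N))%:R.
Proof.
(* The iterated logarithm is at most [20 l + 20] and the gap at least [l / 2], so [1 / 100] suffices
   once [l >= 1000]. *)
exists 100^-1; split; first by rewrite invr_gt0.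
have [m m1] : exists m, (1000 * 20 <= m)%N by exists (1000 * 20)%N.
exists (2 ^ (2 ^ m))%N => N hN.
have N0 : (0 < N)%N by apply: leq_trans hN; rewrite expn_gt0.
pose u := trunc_log 2 N; pose v := trunc_log 2 u; pose l := (v %/ 20)%N.
have /andP[Nu Nu1] := trunc_log_bounds (isT : 1 < 2)%N N0; rewrite -/u in Nu Nu1.
have um : (2 ^ m <= u)%N by apply: trunc_log_max.
have u0 : (0 < u)%N by apply: leq_trans um; rewrite expn_gt0.
have /andP[uv uv1] := trunc_log_bounds (isT : 1 < 2)%N u0; rewrite -/v in uv uv1.
have vm : (m <= v)%N by apply: trunc_log_max.
have l1 : (1000 <= l)%N by rewrite leq_divRL // (leq_trans m1).
have lv : (20 * l <= v < 20 * l + 20)%N by rewrite mulnC leq_trunc_div addnC -mulSn ltn_ceil.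
have uu : (u < 2 ^ (20 * l + 20))%N.
  by apply: leq_trans uv1 _; rewrite leq_exp2l //; case/andP: lv.
have ul : (2 ^ (20 * l) <= u)%N.
  by apply: leq_trans uv; rewrite leq_exp2l //; case/andP: lv.
have gap := @paint_choice_gap R N u l l1 ul uu Nu Nu1.
have N1 : 1 < N%:R :> R.
  by rewrite ltr1n; apply: leq_trans Nu; rewrite -{1}(expn1 2) leq_exp2l.
have logN0 : 0 < log2 (N%:R : R) by apply: divr_gt0; [exact: ln_gt0 | exact: ln2_gt0].
have logN : log2 (N%:R : R) <= 2 ^+ (20 * l + 20).
  apply: (@le_trans _ _ (u.+1)%:R); last by rewrite -natrX ler_nat.
  by apply: log2_le; [exact: lt_trans ltr01 N1 | rewrite -natrX ler_nat ltnW].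
have loglogN : log2 (log2 (N%:R : R)) <= 20 * l%:R + 20.
  by have := log2_le logN0 logN; rewrite natrD natrM.
have gapR : (choice_number (biclique N N))%:R + l%:R / 2 <= (paint_number (biclique N N))%:R :> R.
  have : (choice_number (biclique N N) * 2 + l <= paint_number (biclique N N) * 2)%N.
    by move: gap; clear; lia.
  by rewrite -(ler_nat R) natrD !natrM; lra.
have : (1000 : R) <= l%:R by rewrite ler_nat.
by lra.
Qed.
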